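(* Let $n\ge1$. If there exists a Morin map $\mathbb{RP}^n\to\mathbb{R}^{n+k}$, then $k\ge\kappa(n)-1$, where $\kappa(n)$ is the integer defined in the context.
   Context: A Morin map is a smooth map $f$ without $\Sigma^2$-points (closure taken), i.e. with $\dim\ker(d_xf)\le1$ at every point $x$. Definition of $\kappa(n)$. Let $n$ have $t$ binary digits, $2^{t-1}\le n<2^t$, and let $L(t)=\lfloor 2^{t+1}/3\rfloor$ (the largest $t$-digit binary number without two consecutive $1$'s). Exactly one case holds: a) no consecutive $1$'s in the binary expansion of $n$, $n$ even; b) no consecutive $1$'s, $n$ odd; c) there are consecutive $1$'s and $n>L(t)$; d) there are consecutive $1$'s and $n<L(t)$. In case d) let $u$ be the largest integer such that $n=2^u(8a+3)+b$ with $0\le b<2^u$ (binary expansion $[a][0,1,1][b]$); then $a$ has no consecutive $1$'s. With $2^p$ the largest power of 2 dividing $n$: $\kappa(n)=\frac{n-2^p}{2}+1$ in case a); $\frac{n-1}{2}$ in case b); $2^t-n-1$ in case c); $2^{u+2}a+(2^u-1-b)$ in case d). *)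

(* Defs.v *)
From HB Require Import structures.
From mathcomp Require Import all_boot all_order all_algebra.
From mathcomp Require Import generic_quotient.
From mathcomp Require Import all_classical all_reals all_analysis.

Set Implicit Arguments.
Unset Strict Implicit.
Unset Printing Implicit Defensive.

Import Order.TTheory GRing.Theory Num.Theory.
Import numFieldNormedType.Exports.

(* The function kappa *)

Local Open Scope nat_scope.

Definition bit (n i : nat) : bool := odd (n %/ 2 ^ i).

Definition consecutive_ones (n : nat) : bool :=
  [exists i : 'I_n, bit n i && bit n i.+1].

(* For n > 0: the t with 2 ^ (t - 1) <= n < 2 ^ t. *)
Definition ndigits (n : nat) : nat := (trunc_log 2 n).+1.

Definition Lmax (t : nat) : nat := 2 ^ t.+1 %/ 3.

(* By uniqueness of Euclidean division, n = 2 ^ u * (8 * a + 3) + b with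
   b < 2 ^ u holds iff the condition under \max does, and then
   a = n %/ 2 ^ (u + 3) and b = n %% 2 ^ u; such a u is < n. *)
Definition kappa_u (n : nat) : nat :=
  \max_(u < n | (n %/ 2 ^ u) %% 8 == 3) u.
Definition kappa_a (n : nat) : nat := n %/ 2 ^ (kappa_u n + 3).
Definition kappa_b (n : nat) : nat := n %% 2 ^ kappa_u n.

(* No subtraction below is truncated when n > 0. *)
Definition kappa (n : nat) : nat :=
  let t := ndigits n in
  if ~~ consecutive_ones n then
    if odd n then (n - 1) %/ 2
    else (n - 2 ^ logn 2 n) %/ 2 + 1
  else if Lmax t < n then 2 ^ t - n - 1
  else 2 ^ (kappa_u n + 2) * kappa_a n + (2 ^ kappa_u n - 1 - kappa_b n).

(* Real projective space *)

Local Open Scope ring_scope.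

Section Projective.
Variables (R : realType) (n : nat).

Definition nzvec : Type := {x : 'rV[R]_n.+1 | x != 0}.

Definition same_line (x y : nzvec) : bool := (val x == val y)%MS.

Lemma same_line_refl : reflexive same_line.
Proof. by move=> x; rewrite /same_line submx_refl. Qed.

Lemma same_line_sym : symmetric same_line.
Proof. by move=> x y; rewrite /same_line andbC. Qed.

Lemma same_line_trans : transitive same_line.
Proof.
move=> y x z /andP[xy yx] /andP[yz zy].
by apply/andP; split; [apply: submx_trans xy yz | apply: submx_trans zy yx].
Qed.

Canonical same_line_equiv :=
  EquivRel same_line same_line_refl same_line_sym same_line_trans.

Definition RP : Type := {eq_quot same_line_equiv}%qT.

Definition homogeneous (i : 'I_n.+1) (y : 'rV[R]_n) : 'rV[R]_n.+1 :=
  \row_j (if unlift i j is Some l then y 0 l else 1).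

Lemma homogeneous_neq0 i y : homogeneous i y != 0.
Proof.
apply/eqP => /rowP/(_ i); rewrite !mxE unlift_none => /eqP.
by rewrite oner_eq0.
Qed.

(* Inverse of the i-th standard chart of RP^n:
   (y_0, ..., y_(n-1)) |-> [y_0 : ... : 1 : ... : y_(n-1)], 1 in position i.
   The images, for i <= n, are the usual affine open sets covering RP^n. *)
Definition chart_inv (i : 'I_n.+1) (y : 'rV[R]_n) : RP :=
  \pi_RP%qT
    (exist (fun x : 'rV[R]_n.+1 => x != 0) _ (homogeneous_neq0 i y)).

End Projective.

(* Smooth maps and Morin maps *)

Section Smooth.
Variable R : realType.

(* On R^p, being C^(r+1) amounts to being differentiable with all directional
   derivatives x |-> 'D_v f x of class C^r. *)
Fixpoint class_C (p q r : nat) (f : 'rV[R]_p -> 'rV[R]_q) : Prop :=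
  match r with
  | 0%N => continuous f
  | r'.+1 => (forall x, differentiable f x) /\
             (forall v, class_C r' (fun x => 'D_v f x))
  end.

Definition smooth_RP (n m : nat) (f : RP R n -> 'rV[R]_m) : Prop :=
  forall (i : 'I_n.+1) (r : nat), class_C r (f \o chart_inv i).

(* Jacobians act on row vectors from the right, so the rows of kermx span the
   kernel of the differential. *)
Definition dim_ker_diff (p q : nat) (g : 'rV[R]_p -> 'rV[R]_q)
    (y : 'rV[R]_p) : nat :=
  \rank (kermx ('J g y)).

Definition Morin_map (n m : nat) (f : RP R n -> 'rV[R]_m) : Prop :=
  smooth_RP f /\
  forall (i : 'I_n.+1) (y : 'rV[R]_n),
    (dim_ker_diff (f \o chart_inv i) y <= 1)%N.

End Smooth.

(* Main.v *)
Require Import Defs.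
From mathcomp Require Import all_boot all_order all_algebra.
From mathcomp Require Import generic_quotient.
From mathcomp Require Import all_classical all_reals all_analysis.
From mathcomp Require Import ring lra zify.
Import Order.TTheory GRing.Theory Num.Theory.
Import numFieldNormedType.Exports.
Set Implicit Arguments.
Unset Strict Implicit.
Unset Printing Implicit Defensive.
Local Open Scope classical_set_scope.
Local Open Scope ring_scope.

(** Let f be a Morin map from RP^n to R^m and let F be the composite of f with
    the projection of R^(n+1) minus the origin. A vector u orthogonal to x is a
    tangent vector of RP^n at the line of x, and the derivative D_u F(x) changes
    sign when x or u does. A plane in the kernel of the differential of f would
    thus be a triple of nonzero, pairwise orthogonal vectors (x, u, v) with
    D_u F(x) = 0 and D_v F(x) = 0; the Morin condition says that there is none.

    Choose M > m. The conditions D_u F(x) = 0 and <x, u> = 0, completed by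
    trivial equations 0 = 0, are M equations on a triple of lines which are odd
    in x and in u; the same holds for v; and <u, v> = 0 is odd in u and in v. On
    (RP^n)^3, whose mod 2 cohomology is generated by classes again called x, u
    and v with x^(n+1) = u^(n+1) = v^(n+1) = 0, these 2M + 1 equations form a
    section of a vector bundle with Euler class (x + u)^M (x + v)^M (u + v).
    They have a common solution as soon as this class is not zero
    ([borsuk_ulam_product], applied in [Morin_target]).

    Put e = n or n - 1, whichever is even, and define j by
    n + kappa n - 1 = e + j. Take M = e + j. The coefficient of the monomial
    x^e u^(2j+1) v^e is C(M, 2j) C(M, e) + C(M, 2j+1) C(M, e-1). As j is even, so
    is M, and the second product is even. The first one is odd by the theorem of
    Lucas, and 2j + 1 <= n ([kappa_excess_exists]): this is where the binary
    expansion of n enters. The basic case is that C(3h, h) is odd when h has no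
    two consecutive binary ones ([odd_bin_triple]). Hence M > m is impossible,
    which is the claim m >= n + kappa n - 1.

    The existence of a solution is proved without cohomology groups. In
    spherical coordinates the product of spheres becomes a cube, which is cut
    into a fine grid. If s j is the sign of the equation number j, iterating
    W |-> d (s j * W) from the constant cochain 1, with d the mod 2 cubical
    coboundary, gives a cochain W of top degree. It represents the cup product
    of the classes of the equations. It vanishes on every cell on which some s j
    is constant ([cup_face]). On the other hand, its sum over all cells is a sum
    over the boundary of the cube. The antipodal identifications on opposite
    sides of the cube reduce it by induction to the required coefficient of the
    Euler class ([cup_sum_step], [cup_sum_tops]). So if this coefficient is odd,
    every grid has a cell on which all equations change sign, and a limit of
    such cells is a solution. *)

(** * Binomial coefficients modulo 2 *)

Section BinomialMod2.
Local Open Scope nat_scope.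

(** The theorem of Lucas at the prime 2, for the last binary digit. All four
    cases are proved together because each row of the triangle uses the
    previous one. *)
Lemma odd_bin_double n k :
  (odd 'C(n.*2, k.*2) = odd 'C(n, k)) * (odd 'C(n.*2, k.*2.+1) = false) *
  (odd 'C(n.*2.+1, k.*2) = odd 'C(n, k)) *
  (odd 'C(n.*2.+1, k.*2.+1) = odd 'C(n, k)).
Proof.
have row n' : (forall k', odd 'C(n'.*2, k'.*2) = odd 'C(n', k')) ->
    (forall k', odd 'C(n'.*2, k'.*2.+1) = false) -> forall k',
    (odd 'C(n'.*2.+1, k'.*2) = odd 'C(n', k')) *
    (odd 'C(n'.*2.+1, k'.*2.+1) = odd 'C(n', k')).
  move=> He Ho k'; split; last by rewrite binS oddD Ho He.
  case: k' => [|k']; first by rewrite !bin0.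
  by rewrite doubleS binS oddD -doubleS He Ho addbF.
elim: n k => [|n IHn] k.
  have He k' : odd 'C(0.*2, k'.*2) = odd 'C(0, k').
    by case: k' => [|k']; rewrite ?bin0 // !bin0n.
  have Ho k' : odd 'C(0.*2, k'.*2.+1) = false by rewrite bin0n.
  by rewrite He Ho !(row 0).
have He k' : odd 'C(n.+1.*2, k'.*2) = odd 'C(n.+1, k').
  case: k' => [|k']; first by rewrite !bin0.
  rewrite !doubleS binS oddD -doubleS !IHn binS oddD //.
have Ho k' : odd 'C(n.+1.*2, k'.*2.+1) = false.
  by rewrite doubleS binS oddD !IHn addbb.
by rewrite He Ho !(row n.+1).
Qed.

(** The theorem of Lucas at the prime 2, for a block of [u] final digits. *)
Lemma odd_bin_pow2 u A B x y : x < 2 ^ u -> y < 2 ^ u ->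
  odd 'C(2 ^ u * A + x, 2 ^ u * B + y) = odd 'C(A, B) && odd 'C(x, y).
Proof.
elim: u A B x y => [|u IHu] A B x y.
  by rewrite expn0 !ltnS !leqn0 !mul1n => /eqP-> /eqP->; rewrite !addn0 andbT.
rewrite expnS => ltx lty.
have dbl z C : 2 * 2 ^ u * C + z = (2 ^ u * C + z./2).*2 + odd z.
  by rewrite -{1}(odd_double_half z); lia.
have lth z : z < 2 * 2 ^ u -> z./2 < 2 ^ u.
  by rewrite -{1}(odd_double_half z); lia.
have hx : x = (x./2).*2 + odd x by lia.
have hy : y = (y./2).*2 + odd y by lia.
rewrite !dbl [in RHS]hx [in RHS]hy.
by case: (odd x); case: (odd y); rewrite ?addn1 ?addn0 !odd_bin_double
  ?IHu ?lth // andbF.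
Qed.

Lemma odd_bin_pow2B1 u y : y < 2 ^ u -> odd 'C(2 ^ u - 1, y).
Proof.
elim: u y => [|u IHu] y; first by rewrite ltnS leqn0 => /eqP->.
rewrite expnS => lty.
have -> : 2 * 2 ^ u - 1 = (2 ^ u - 1).*2.+1 by have := expn_gt0 2 u; lia.
have hy : y = (y./2).*2 + odd y by lia.
have lth : y./2 < 2 ^ u by lia.
by rewrite hy; case: (odd y); rewrite ?addn1 ?addn0 !odd_bin_double IHu.
Qed.

Lemma odd_bin_pow2B2 u y : 0 < u -> y < 2 ^ u -> ~~ odd y ->
  odd 'C(2 ^ u - 2, y).
Proof.
case: u => // u _; rewrite expnS => lty ey.
have -> : 2 * 2 ^ u - 2 = (2 ^ u - 1).*2 by lia.
have -> : y = (y./2).*2 by lia.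
by rewrite odd_bin_double odd_bin_pow2B1 //; lia.
Qed.

End BinomialMod2.

(** * The function kappa *)

Section BinaryExpansion.
Local Open Scope nat_scope.

Definition spread n := forall i, bit n i -> ~~ bit n i.+1.

Lemma bit_S n i : bit n i.+1 = bit n./2 i.
Proof. by rewrite /bit expnS divnMA divn2. Qed.

Lemma bit_0 n : bit n 0 = odd n.
Proof. by rewrite /bit expn0 divn1. Qed.

Lemma bit_ltn n i : bit n i -> i < n.
Proof.
rewrite /bit => bi; have le : 2 ^ i <= n.
  by rewrite leqNgt; apply: contraL bi => lt; rewrite divn_small.
exact: leq_trans (ltn_expl i (isT : 1 < 2)) le.
Qed.

Lemma consecutive_onesPn n : ~~ consecutive_ones n -> spread n.
Proof.
move=> /existsPn nc i bi; have := nc (Ordinal (bit_ltn bi)).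
by rewrite /= bi.
Qed.

Lemma spread_half n : spread n -> spread n./2.
Proof. by move=> sn i; rewrite -!bit_S; apply: sn. Qed.

Lemma spread_odd n : spread n -> odd n -> ~~ odd n./2.
Proof. by move=> sn on; rewrite -bit_0 -bit_S; apply: sn; rewrite bit_0. Qed.

(** When no two ones are adjacent, adding [h] and [2 * h] in base 2 creates no
    carry, so this is the criterion of Kummer. The proof strips one final digit
    0 or two final digits 01. *)
Lemma odd_bin_triple h : spread h -> odd 'C(3 * h, h).
Proof.
elim/ltn_ind: h => h IHh sh.
have [->|h0] := posnP h; first by rewrite bin0.
have e3 m : 3 * m.*2 = (3 * m).*2 by lia.
have oh := spread_odd sh; have sh2 := spread_half sh.
have eh := odd_double_half h; case: (odd h) eh oh => eh oh; last first.
  by rewrite -eh e3 odd_bin_double IHh //; lia.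
have eh2 : h./2 = (h./2./2).*2 by lia.
have -> : 3 * h = ((3 * h./2./2).*2.+1).*2.+1 by lia.
have {2}-> : h = ((h./2./2).*2).*2.+1 by lia.
by rewrite !odd_bin_double IHh //; [lia | exact: spread_half].
Qed.

Lemma odd_bin_triple2 h : spread h -> odd 'C(3 * h, 2 * h).
Proof.
move=> sh; rewrite -bin_sub; last by lia.
by have -> : 3 * h - 2 * h = h by [lia]; apply: odd_bin_triple.
Qed.

(** Take the highest pair of adjacent ones. *)
Lemma bit_block011 n i : bit n i -> bit n i.+1 ->
  exists2 u, i <= u & (n %/ 2 ^ u) %% 8 = 3.
Proof.
move=> b0 b1.
have ex : exists m, bit n m && bit n m.+1 by exists i; rewrite b0.
have ub m : bit n m && bit n m.+1 -> m <= n.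
  by case/andP=> /bit_ltn /ltnW.
case: (ex_maxnP ex ub) => m /andP[bm bm1] mx.
exists m; first by apply: mx; rewrite b0.
have := mx m.+1; rewrite bm1 ltnn /=; move: bm bm1; rewrite /bit.
have -> : 2 ^ m.+2 = 2 ^ m * 4 by rewrite !expnS; lia.
have -> : 2 ^ m.+1 = 2 ^ m * 2 by rewrite !expnS; lia.
rewrite !divnMA; set q := n %/ _ => h1 h2 h3.
have : ~~ odd (q %/ 4) by apply/negP => /h3.
move: h1 h2 {h3}; lia.
Qed.

End BinaryExpansion.

Section Kappa.
Local Open Scope nat_scope.
Variables (n : nat) (n_gt0 : 0 < n).

(** With [M = (n./2).*2 + j], so that [M = n + kappa n - 1], these conditions
    make the coefficient of [x^e u^(2j+1) v^e], where [e = (n./2).*2], in [(x +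
    u)^M (x + v)^M (u + v)] odd, with all exponents at most [n]. *)
Definition kappa_excess j :=
  [/\ ~~ odd j, kappa n + n = (n./2).*2 + j + 1, j.*2 < n,
      odd 'C((n./2).*2 + j, j) & odd 'C((n./2).*2 + j, j.*2)].

(** Here [j] is half of the number obtained from [n] by deleting its last
    binary one. *)
Lemma kappa_excess_spread : ~~ consecutive_ones n -> exists j, kappa_excess j.
Proof.
move=> nc; have sn := consecutive_onesPn nc.
rewrite /kappa_excess /kappa nc; case: ifP => on.
  have oh := spread_odd sn on; have sh := spread_half sn.
  have eh : n = (n./2).*2.+1 by lia.
  exists n./2; split; [exact: oh| lia | lia | |].
    by have -> : (n./2).*2 + n./2 = 3 * n./2 by [lia]; apply: odd_bin_triple.
  have -> : (n./2).*2 + n./2 = 3 * n./2 by lia.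
  by rewrite -mul2n; apply: odd_bin_triple2.
set p := logn 2 n.
have [q oq en] : exists2 q, odd q & n = 2 ^ p * q.
  have [q nd ->] := pfactor_coprime (isT : prime 2) n_gt0.
  by exists q; [rewrite -coprime2n | rewrite mulnC].
have p_gt0 : 0 < p by rewrite logn_gt0 mem_primes n_gt0 dvdn2 on.
have [k oq2] : exists k, q = k.*2.*2.+1 /\ spread k.
  have sq : spread q.
    move=> i; have := sn (p + i); rewrite /bit en -addnS !expnD.
    by rewrite !divnMA !mulKn ?expn_gt0.
  exists q./2./2; split; last by do 2!apply: spread_half.
  have := spread_odd sq oq; lia.
case: oq2 => eq sk; exists (2 ^ p * k.*2).
have -> : (n./2).*2 = n by lia.
have ep : 2 ^ p = (2 ^ p.-1).*2 by rewrite -mul2n -expnS prednK.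
have -> : n + 2 ^ p * k.*2 = 2 ^ p * (3 * k).*2.+1 by rewrite en eq; lia.
have -> : (2 ^ p * k.*2).*2 = 2 ^ p * (2 * k).*2 by lia.
have H A B : odd 'C(2 ^ p * A, 2 ^ p * B) = odd 'C(A, B).
  have := @odd_bin_pow2 p A B 0 0; rewrite !addn0 bin0 andbT => -> //;
  by rewrite expn_gt0.
split.
- by rewrite ep -doubleMl odd_double.
- by move: ep en; rewrite eq; set x := 2 ^ p; set y := 2 ^ p.-1; nia.
- by rewrite en eq ltn_pmul2l ?expn_gt0 //; lia.
- by rewrite H odd_bin_double odd_bin_triple.
- by rewrite H odd_bin_double odd_bin_triple2.
Qed.

(** Here [j] is the complement of [n] among the binary digits of positions 1,
    ..., t - 1. The assumption on [n] gives the bound on [j]. *)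
Lemma kappa_excess_large : consecutive_ones n -> Lmax (ndigits n) < n ->
  exists j, kappa_excess j.
Proof.
move=> nc; rewrite /kappa_excess /kappa nc /= => lt; rewrite lt.
move: lt; rewrite /Lmax; set t := ndigits n => lt.
have n1 : 1 < n.
  case/existsP: nc => i /andP[_]; rewrite bit_S => /bit_ltn; lia.
have ltnt : n < 2 ^ t by apply: trunc_log_ltn.
have [t' et t'_gt0] : exists2 t', t = t'.+1 & 0 < t'.
  by exists (trunc_log 2 n) => //; rewrite trunc_log_gt0.
have le' : 2 ^ t' <= n.
  by move: et => [<-]; apply: trunc_logP.
have et2 : 2 ^ t = (2 ^ t').*2 by rewrite et expnS mul2n.
have et3 : 2 ^ t' = (2 ^ t'.-1).*2 by rewrite -mul2n -expnS prednK.
have lt2 : 2 ^ t'.+2 < 3 * n.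
  move: lt; rewrite et; have := divn_eq (2 ^ t'.+2) 3.
  have := ltn_pmod (2 ^ t'.+2) (isT : 0 < 3); lia.
have et4 : 2 ^ t'.+2 = (2 ^ t).*2 by rewrite et2 !expnS; lia.
have e : (n./2).*2 + (2 ^ t - 2 - (n./2).*2) = 2 ^ t - 2 by lia.
exists (2 ^ t - 2 - (n./2).*2); rewrite e.
split; [lia | lia | lia | |]; apply: odd_bin_pow2B2; lia.
Qed.

(** Write [n] in binary as [a]011[b]. The high part of [j] is [a], shifted
    right by one place, and its low part is the complement of [b] apart from
    the last digit. The digits [a] contain no two consecutive ones because [u]
    is maximal. *)
Lemma kappa_excess_small : consecutive_ones n -> n <= Lmax (ndigits n) ->
  exists j, kappa_excess j.
Proof.
move=> nc; rewrite /kappa_excess /kappa nc /= => le; rewrite ltnNge le /=.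
case/existsP: nc => i /andP[bi bi1].
have [u0 _ eu0] := bit_block011 bi bi1.
have ltu w : (n %/ 2 ^ w) %% 8 = 3 -> w < n.
  move=> ew; apply: (@leq_trans (2 ^ w)); first exact: ltn_expl.
  by rewrite leqNgt; apply/negP => lt; rewrite divn_small in ew.
have eu : (n %/ 2 ^ kappa_u n) %% 8 = 3.
  rewrite /kappa_u (bigop.bigmax_eq_arg (Ordinal (ltu _ eu0))) /= ?eu0 //.
  by case: arg_maxnP => [|w /eqP //]; rewrite /= eu0.
have umax w : (n %/ 2 ^ w) %% 8 = 3 -> w <= kappa_u n.
  by move=> ew; apply: (bigop.bigmax_sup (Ordinal (ltu _ ew))) => //=; apply/eqP.
rewrite /kappa_a /kappa_b; set u := kappa_u n in eu umax *.
set a := n %/ _; set b := n %% _.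
have en : n = 2 ^ u * (8 * a + 3) + b.
  rewrite {1}(divn_eq n (2 ^ u)) {1}(divn_eq (n %/ 2 ^ u) 8) eu -divnMA.
  by rewrite -(expnD 2 u 3) -/a -/b mulnC (mulnC a).
have ltb : b < 2 ^ u by rewrite ltn_mod expn_gt0.
have sa : spread a.
  move=> k; rewrite /bit /a -!divnMA -!expnD (addnS _ k) => bk.
  apply/negP => bk1.
  have [w lew ew] := bit_block011 bk bk1.
  by move: lew (umax w ew); clear; lia.
have H A B x y : x < 2 ^ u -> y < 2 ^ u ->
  odd 'C(2 ^ u * A + x, 2 ^ u * B + y) = odd 'C(A, B) && odd 'C(x, y).
  exact: odd_bin_pow2.
have ev4 : 12 * a + 3 = ((3 * a).*2.+1).*2.+1 by lia.
have ev4' : 12 * a + 2 = ((3 * a).*2.+1).*2 by lia.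
rewrite expnD; clearbody u a b; rewrite expnS expn1 (_ : 2 * 2 = 4) //.
case: u => [|u] in en ltb H eu umax *.
  move: en ltb; rewrite expn0 ltnS leqn0 => en /eqP b0; subst b.
  have -> : (n./2).*2 = 8 * a + 2 by lia.
  exists (4 * a); have -> : 8 * a + 2 + 4 * a = 12 * a + 2 by lia.
  have e1 : 4 * a = a.*2.*2 by lia.
  have e2 : (4 * a).*2 = (2 * a).*2.*2 by lia.
  split; [lia | lia | lia | |].
    by rewrite ev4' e1 !odd_bin_double odd_bin_triple.
  by rewrite ev4' e2 !odd_bin_double odd_bin_triple2.
move: en ltb H; rewrite expnS; set x := 2 ^ u => en ltb H.
have x0 : 0 < x by rewrite expn_gt0.
have eh : (n./2).*2 = 2 * x * (8 * a + 3) + (b./2).*2.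
  by move: en; rewrite -mulnA; set m := x * _ => en; lia.
pose r := 2 * x - 2 - (b./2).*2.
have er : (b./2).*2 + r = 2 * x - 2 by lia.
exists (2 * x * (4 * a) + r).
have ltr : r < 2 * x by lia.
have evr : ~~ odd r by lia.
have ex : forall y, y < 2 * x -> ~~ odd y -> odd 'C(2 * x - 2, y).
  by move=> y lty oy; have := @odd_bin_pow2B2 u.+1 y; rewrite expnS; apply.
have -> : (n./2).*2 + (2 * x * (4 * a) + r) = 2 * x * (12 * a + 3) + (2 * x - 2).
  by rewrite eh -er; lia.
split.
- by rewrite oddD -mulnA mul2n odd_double.
- lia.
- lia.
- rewrite H; [|lia|lia]; rewrite ex // andbT.
  have -> : 4 * a = a.*2.*2 by lia.
  by rewrite ev4 !odd_bin_double odd_bin_triple.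
(* Doubling the low part r of j may produce a carry eps. It falls on a digit 1
   of e + j, hence is harmless. *)
- have [eps [y [e2r lty evy]]] : exists eps, exists y,
     [/\ r.*2 = 2 * x * nat_of_bool eps + y, y < 2 * x & ~~ odd y].
    exists (2 * x <= r.*2), (r.*2 - 2 * x * (2 * x <= r.*2)).
    case: leqP => ?; split; lia.
  have -> : (2 * x * (4 * a) + r).*2 = 2 * x * (8 * a + eps) + y by lia.
  rewrite H //; [|lia]; rewrite ex // andbT.
  rewrite ev4 (_ : 8 * a + eps = (2 * a).*2.*2 + eps); last by lia.
  by case: eps {e2r}; rewrite ?addn1 ?addn0 !odd_bin_double odd_bin_triple2.
Qed.

Lemma kappa_excess_exists : exists j, kappa_excess j.
Proof.
have [nc|] := boolP (consecutive_ones n); last exact: kappa_excess_spread.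
by have [/kappa_excess_small|/kappa_excess_large] := leqP n (Lmax (ndigits n));
  apply.
Qed.

End Kappa.

(** * Cubical cochains modulo 2 *)

Notation "\xor_ ( i | P ) F" := (\big[addb/false]_(i | P%B) F)
  (at level 41, F at level 41, i, P at level 60).
Notation "\xor_ i F" := (\big[addb/false]_i F)
  (at level 41, F at level 41, i at level 0).

Section Cells.
Local Open Scope nat_scope.
Variable I : finType.
Notation cell := (I -> nat).

Definition upd (p : cell) i v : cell := fun x => if x == i then v else p x.

Lemma updE p i v x : upd p i v x = if x == i then v else p x.
Proof. by []. Qed.

Lemma updC p i j u v : i != j -> upd (upd p i u) j v = upd (upd p j v) i u.
Proof.
move=> nij; apply/funext => x; rewrite !updE.
by have [->|//] := eqVneq x j; rewrite eq_sym (negPf nij).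
Qed.

(** The terms of index [(i, j)] and [(j, i)] cancel. *)
Lemma xor_symmetric (P : pred I) (g : I -> I -> bool) :
    (forall i j, g i j = g j i) ->
  \xor_(i | P i) \xor_(j | P j && (j != i)) g i j = false.
Proof.
move=> gC; pose lt (i j : I) := enum_rank i < enum_rank j.
have ltE i j : (j != i) = lt i j || lt j i.
  by rewrite -(inj_eq enum_rank_inj) /lt -neq_ltn eq_sym.
have ltA i j : lt i j -> ~~ lt j i by rewrite /lt -leqNgt => /ltnW.
rewrite (eq_bigr (fun i => (\xor_(j | P j && lt i j) g i j) (+)
    (\xor_(j | P j && lt j i) g i j))); last first.
  move=> i _; rewrite (bigID (fun j => lt i j)) /=.
  congr addb; apply: eq_bigl => j; rewrite ltE -andbA; congr andb.
    by case: (lt i j); rewrite ?andbF.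
  by move: (ltA i j); case: (lt i j) => [/(_ isT)/negPf->|]; rewrite ?andbT.
rewrite big_split /=.
rewrite (exchange_big_dep P) /=; last by move=> i j _ /andP[].
rewrite [X in X (+) _](eq_bigr (fun j => \xor_(i | P i && lt i j) g j i)).
  by rewrite addbb.
by move=> j Pj; apply: eq_big => [i|i _]; [rewrite Pj andTb | apply: gC].
Qed.

Lemma xor_witness (P F : pred I) :
  \xor_(i | P i) F i -> exists2 i, P i & F i.
Proof.
apply: (big_rec (fun b : bool => b -> exists2 i, P i & F i)) => // i b Pi IHb.
by case E : (F i) => // _; exists i.
Qed.

(** A cell of the cubical grid is encoded by doubled coordinates: an even
    coordinate is a vertex of the grid, and an odd one is the open edge between
    its two neighbours. The facets of a cell are obtained by moving one odd
    coordinate to a neighbour. Cochains have coefficients in the field with two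
    elements. *)
Definition coboundary (w : cell -> bool) (p : cell) : bool :=
  \xor_(i | odd (p i)) (w (upd p i (p i).-1) (+) w (upd p i (p i).+1)).

(** A facet of a facet lies in exactly two facets. *)
Lemma coboundary_coboundary w p : coboundary (coboundary w) p = false.
Proof.
pose g i j := w (upd (upd p i (p i).-1) j (p j).-1)
  (+) w (upd (upd p i (p i).-1) j (p j).+1)
  (+) (w (upd (upd p i (p i).+1) j (p j).-1)
  (+) w (upd (upd p i (p i).+1) j (p j).+1)).
have cE i v : odd (p i) -> ~~ odd v -> coboundary w (upd p i v) =
    \xor_(j | odd (p j) && (j != i)) (w (upd (upd p i v) j (p j).-1)
      (+) w (upd (upd p i v) j (p j).+1)).
  move=> oi ov; apply: eq_big => [j|j].
    by rewrite updE; case: eqVneq => [->|]; rewrite ?andbT // (negPf ov) andbF.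
  by rewrite updE; case: eqVneq => [_|//]; rewrite (negPf ov).
rewrite [coboundary _ p]/coboundary (eq_bigr (fun i =>
    \xor_(j | odd (p j) && (j != i)) if j == i then false else g i j)).
  apply: xor_symmetric => i j; rewrite [j == i]eq_sym.
  have [//|nij] := eqVneq i j.
  rewrite /g !(updC _ _ _ nij).
  by do 4!case: (w _).
move=> i oi; rewrite !cE -?big_split //=; last by lia.
  by apply: eq_bigr => j /andP[_ /negPf->].
by lia.
Qed.

Lemma coboundaryD w1 w2 p : coboundary (fun q => w1 q (+) w2 q) p =
  coboundary w1 p (+) coboundary w2 p.
Proof.
rewrite /coboundary -big_split; apply: eq_bigr => i _ /=.
by do 4!case: (_ (upd _ _ _)).
Qed.

(** As [cup s k] is a cocycle, the coboundary of its product with a 0-cochain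
    [s k] represents the cup product with the coboundary of [s k]. The label of
    a cell of positive dimension stands for the value of that 0-cochain at the
    centre of the cell, which makes a cellwise product possible. *)
Fixpoint cup (s : nat -> cell -> bool) k : cell -> bool :=
  if k is k'.+1 then coboundary (fun q => s k' q && cup s k' q) else xpredT.

Lemma coboundary_cup s k p : coboundary (cup s k) p = false.
Proof.
case: k => [|k]; last exact: coboundary_coboundary.
by rewrite /coboundary big1.
Qed.

Definition is_face (p q : cell) :=
  forall x, q x = p x \/ odd (p x) /\ (q x = (p x).-1 \/ q x = (p x).+1).

Lemma is_face_refl p : is_face p p. Proof. by left. Qed.

Lemma is_face_upd p i b : odd (p i) ->
  is_face p (upd p i (if b then (p i).+1 else (p i).-1)).
Proof.
move=> oi x; rewrite updE; case: eqVneq => [->|_]; last by left.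
by right; split => //; case: b; [right|left].
Qed.

Lemma is_face_trans p q t : is_face p q -> is_face q t -> is_face p t.
Proof.
move=> pq qt x; case: (pq x) => [e | [odd_p e]]; first by move: (qt x); rewrite e.
right; split => //; case: (qt x) => [-> // | [odd_q _]]; exfalso.
by move: odd_p odd_q; case: e => ->; lia.
Qed.

(** As [cup s k] is a cocycle, adding the constant [s k p] to [s k] leaves [cup
    s k.+1 p] unchanged. So if [cup s k.+1 p] is nonzero, then some facet [q]
    of [p] satisfies [s k q != s k p] and [cup s k q]; descend along such
    facets. *)
Lemma cup_face s k p : cup s k p -> forall j, j < k ->
  exists q q', [/\ is_face p q, is_face p q', s j q & ~~ s j q'].
Proof.
elim: k p => [//|k IHk] p /=.
have -> : coboundary (fun q => s k q && cup s k q) p =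
    coboundary (fun q => (s k q (+) s k p) && cup s k q) p.
  have := coboundaryD (fun q => s k q && cup s k q) (fun q => s k p && cup s k q) p.
  have -> : coboundary (fun q => s k p && cup s k q) p = false.
    by case: (s k p); [exact: coboundary_cup | rewrite /coboundary big1].
  by rewrite addbF => <-; congr coboundary; apply/funext => q; rewrite andb_addl.
move=> /xor_witness[i oi X].
have [b /andP[sq cq]] : exists b,
    let q := upd p i (if b then (p i).+1 else (p i).-1) in
    (s k q (+) s k p) && cup s k q.
  by case E : ((s k _ (+) _) && _) X => X; [exists false|exists true].
set q := upd _ _ _ in sq cq; have fq : is_face p q := is_face_upd b oi.
move=> j; rewrite ltnS leq_eqVlt => /predU1P[->|ltj].
  by case E : (s k q) sq => /= np; [exists q, p|exists p, q];
     split => //; rewrite ?E //; apply: is_face_refl.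
have [t [t' [qt qt' st st']]] := IHk q cq j ltj.
by exists t, t'; split => //; apply: is_face_trans fq _.
Qed.

End Cells.

(** * A Tucker lemma for products of projective spaces *)

Section Reflection.
Local Open Scope nat_scope.
Variables (I : finType) (L : nat).
Notation cell := (I -> nat).

(** The map from the side [p x = L.*2] of the cube to the side [p x = 0] which
    reverses the coordinates in [R]. For a suitable [R] it realizes the
    antipodal map in spherical coordinates. *)
Definition opposite (R : pred I) (x : I) (p : cell) : cell :=
  fun y => if y == x then 0 else if R y then L.*2 - p y else p y.

(** A constant added to a labelling is killed by the coboundary, and reversing
    a coordinate only exchanges two facets. *)
Lemma cup_opposite (s : nat -> cell -> bool) (c : nat -> bool) k R x
    (Q : cell -> Prop) p :
    (forall q, Q q -> q x = L.*2 /\ forall y, q y <= L.*2) ->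
    (forall q y v, Q q -> odd (q y) -> v <= L.*2 -> Q (upd q y v)) ->
    (forall j q, j < k -> Q q -> s j (opposite R x q) = c j (+) s j q) ->
  Q p -> cup s k (opposite R x p) = cup s k p.
Proof.
move=> Qx Qface; elim: k p => [//|k IHk] p sk Qp /=.
have [px pL] := Qx p Qp.
have {IHk}IH q : Q q -> cup s k (opposite R x q) = cup s k q.
  by apply: IHk => j t ltj; apply: sk; apply: ltnW.
pose w := fun q => s k q && cup s k q.
have upd_opposite y v : odd (p y) ->
    opposite R x (upd p y v) = upd (opposite R x p) y (if R y then L.*2 - v else v).
  move=> oy; apply/funext => z; rewrite /opposite !updE.
  have [->|nzx] := eqVneq z x.
    by case: eqVneq => [e|//]; move: oy; rewrite -e px odd_double.
  by case: eqVneq => // ->.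
have -> : coboundary w (opposite R x p) = coboundary (fun q => w (opposite R x q)) p.
  apply: eq_big => [y|y oy].
    rewrite /opposite; case: eqVneq => [->|_]; first by rewrite px odd_double.
    by case: (R y) => //; rewrite oddB // odd_double.
  have {}oy : odd (p y).
    move: oy; rewrite /opposite; case: eqVneq => [//|_].
    by case: (R y) => //; rewrite oddB // odd_double.
  have nyx : y != x by apply: contraTneq oy => ->; rewrite px odd_double.
  have gy : opposite R x p y = if R y then L.*2 - p y else p y.
    by rewrite /opposite (negPf nyx).
  rewrite !upd_opposite // gy; case: (R y) => //.
  have := pL y; rewrite addbC => le.
  by congr (_ (+) _); congr (w (upd _ _ _)); lia.
transitivity (coboundary (fun q => (c k && cup s k q) (+) w q) p).
  apply: eq_bigr => y oy.
  have le : (p y).+1 <= L.*2 by have := pL y; lia.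
  have Qv v : v <= L.*2 -> Q (upd p y v) by move=> lev; apply: Qface.
  by congr addb; rewrite /w IH ?sk ?andb_addl //; apply: Qv; lia.
rewrite coboundaryD; case: (c k); first by rewrite coboundary_cup.
by rewrite [X in X (+) _]/coboundary big1.
Qed.

End Reflection.

Section Sampling.
Local Open Scope nat_scope.
Variables (I : finType) (L : nat) (oddL : odd L).

Definition fupd (h : {ffun I -> 'I_L}) x t := [ffun y => if y == x then t else h y].

(** Resampling one coordinate of [h] is a bijection of pairs; the number [L] of
    values of that coordinate is odd. This allows sums over a face of the cube
    to be written as sums over all [h], with the superfluous coordinates
    repeated. *)
Lemma xor_resample x (F : {ffun I -> 'I_L} -> bool) :
  \xor_h \xor_t F (fupd h x t) = \xor_h F h.
Proof.
pose sw (u : {ffun I -> 'I_L} * 'I_L) := (fupd u.1 x u.2, u.1 x).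
have swK : involutive sw.
  move=> [h t]; rewrite /sw /=; congr pair; last by rewrite ffunE eqxx.
  by apply/ffunP => y; rewrite !ffunE; case: eqVneq => [->|].
rewrite pair_bigA /= (reindex_inj (inv_inj swK)) /=.
rewrite -(pair_bigA _ (fun h t => F (fupd (fupd h x t) x (h x)))) /=.
apply: eq_bigr => h _.
rewrite (eq_bigr (fun=> F h)) => [|t _].
  rewrite big_const_ord; case: (F h).
    suff E m : iter m (addb true) false = odd m by rewrite E.
    by elim: m => //= m ->.
  by elim: L => //= m ->.
by congr F; apply/ffunP => y; rewrite !ffunE; case: eqVneq => [->|].
Qed.

Lemma xor_telescope x (G : {ffun I -> 'I_L} -> nat -> bool) :
    (forall h t v, G (fupd h x t) v = G h v) ->
  \xor_h (G h (h x).*2 (+) G h (h x).*2.+2) = \xor_h (G h 0 (+) G h L.*2).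
Proof.
move=> GE; rewrite -(xor_resample x); apply: eq_bigr => h _.
under eq_bigr => t _ do rewrite ffunE eqxx !GE.
rewrite -(big_mkord xpredT (fun t => G h t.*2 (+) G h t.*2.+2)).
elim: (L) => [|m IHm]; first by rewrite big_nil addbb.
rewrite big_nat_recr //= IHm doubleS.
by case: (G h m.*2); case: (G h 0); case: (G h _.+2).
Qed.

End Sampling.

Section Blocks.
Local Open Scope nat_scope.
Variables (B : finType) (n : nat).
Notation I := (B * 'I_n)%type.
Notation cell := (I -> nat).

(** The coordinates [(b, i)], for fixed [b], are the spherical coordinates of
    one sphere. When [(b, j)] is at an end of its range, the point no longer
    depends on the coordinates [(b, i)] with [i < j]. *)
Definition above (x : I) : pred I := fun y => (y.1 == x.1) && (x.2 < y.2).

Variable chi : nat -> B -> bool.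

Definition decr (a : B -> nat) (b : B) : B -> nat := fun b' => a b' - (b' == b).

(** The coefficient of the monomial with exponents [a] in the product over [j <
    k] of the linear forms with coefficients [chi j], modulo 2. *)
Fixpoint class_coef k (a : B -> nat) : bool :=
  if k is k'.+1 then \xor_(b | 0 < a b) (chi k' b && class_coef k' (decr a b))
  else [forall b, a b == 0].

Variables (L : nat) (oddL : odd L) (s : nat -> cell -> bool) (N : nat).
Hypothesis s_deg : forall j x y p v, j < N -> above x y -> p y = 0 ->
  s j (upd p x v) = s j p.
Hypothesis s_opposite : forall j x p, j < N -> (forall y, p y <= L.*2) ->
  p x = L.*2 -> s j (opposite L (above x) x p) = chi j x.1 (+) s j p.

Definition subcell (A : {set I}) (h : {ffun I -> 'I_L}) : cell :=
  fun x => if x \in A then (h x).*2.+1 else 0.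

(** The sum of a cup product over the cells of the face of the cube on which
    the coordinates outside [A] are 0, with odd multiplicities. *)
Definition cup_sum (A : {set I}) := \xor_h cup s #|A| (subcell A h).

(** On the side [x] of a face whose free coordinates are [A], the point
    determines its antipode by reversing free coordinates exactly in this case.
    If a coordinate above [x] is fixed, the point does not depend on [x] at
    all. *)
Definition exposed (A : {set I}) x := [forall y, above x y ==> (y \in A)].

Lemma subcell_le A h x : subcell A h x <= L.*2.
Proof. by rewrite /subcell; case: ifP => // _; have := ltn_ord (h x); lia. Qed.

Lemma subcellD1 A h x : upd (subcell A h) x 0 = subcell (A :\ x) h.
Proof.
by apply/funext => y; rewrite updE /subcell in_setD1; case: eqVneq.
Qed.

Lemma upd_subcell_le A h x y : upd (subcell A h) x L.*2 y <= L.*2.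
Proof. by rewrite updE; case: eqVneq => // _; apply: subcell_le. Qed.

Lemma cup_opposite_hidden A h x k : k <= N -> ~~ exposed A x -> x \in A ->
  cup s k (upd (subcell A h) x L.*2) = cup s k (subcell (A :\ x) h) /\
  forall j, j < N ->
    s j (upd (subcell A h) x L.*2) = s j (subcell (A :\ x) h).
Proof.
move=> lek /forallPn[y]; rewrite negb_imply => /andP[xy nyA] xA.
set p := upd _ _ _.
have nyx : y != x by apply: contraTneq xA => <-.
(* The side x = L.*2 is translated to the side x = 0 without any reversal. *)
have gl : opposite L pred0 x p = subcell (A :\ x) h.
  by apply/funext => z; rewrite /opposite /p updE /subcell in_setD1; case: eqVneq.
have py : p y = 0 by rewrite /p updE (negPf nyx) /subcell (negPf nyA).
have gE j q : j < N -> q y = 0 -> s j (opposite L pred0 x q) = s j q.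
  move=> ltj qy; rewrite -(s_deg 0 ltj xy qy); congr (s _ _).
split; last by move=> j ltj; rewrite -gl gE.
rewrite -gl; symmetry.
apply: (@cup_opposite _ _ _ (fun=> false) _ _ _
  (fun q => [/\ q x = L.*2, (forall z, q z <= L.*2) & q y = 0])).
- by move=> q [].
- move=> q z v [qx qL qy] oz lev; split.
  + by rewrite updE; case: eqVneq => // e; move: oz; rewrite -e qx odd_double.
  + by move=> t; rewrite updE; case: eqVneq.
  + by rewrite updE; case: eqVneq => // e; move: oz; rewrite -e qy.
- by move=> j q ltj [_ _ qy]; rewrite gE //; apply: leq_trans ltj lek.
- by split => // [|z]; [rewrite /p updE eqxx | apply: upd_subcell_le].
Qed.

Definition flip_above x (h : {ffun I -> 'I_L}) :=
  [ffun y => if above x y then rev_ord (h y) else h y].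

Lemma flip_aboveK x : involutive (flip_above x).
Proof.
by move=> h; apply/ffunP => y; rewrite !ffunE; case: (above x y); rewrite ?rev_ordK.
Qed.

Lemma cup_opposite_visible A h x k : k <= N -> exposed A x ->
  cup s k (upd (subcell A h) x L.*2) = cup s k (subcell (A :\ x) (flip_above x h)) /\
  forall j, j < N -> s j (upd (subcell A h) x L.*2) =
    chi j x.1 (+) s j (subcell (A :\ x) (flip_above x h)).
Proof.
move=> lek /forallP vis; set p := upd _ _ _.
have px : p x = L.*2 by rewrite /p updE eqxx.
have pL y : p y <= L.*2 by apply: upd_subcell_le.
have gl : opposite L (above x) x p = subcell (A :\ x) (flip_above x h).
  apply/funext => z; rewrite /opposite /p updE /subcell in_setD1.
  case: eqVneq => //= _; rewrite ffunE; have := vis z.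
  case: (above x z) => //= -> /=.
  by have := ltn_ord (h z); rewrite /=; lia.
split; last by move=> j ltj; rewrite -gl s_opposite // addbA addbb.
rewrite -gl; symmetry; apply: (@cup_opposite _ _ _ (chi^~ x.1) _ _ _
  (fun q => q x = L.*2 /\ (forall z, q z <= L.*2))) => //.
- move=> q z v [qx qL] oz lev; split.
    by rewrite updE; case: eqVneq => // e; move: oz; rewrite -e qx odd_double.
  by move=> t; rewrite updE; case: eqVneq.
- by move=> j q ltj [qx qL]; rewrite s_opposite //; apply: leq_trans ltj lek.
Qed.

(** The contributions of the interior walls cancel in pairs, which leaves the
    two sides of the cube at the ends of the range of each free coordinate [x].
    They are identified by [cup_opposite_hidden] or [cup_opposite_visible]. In
    the first case they cancel; in the second one they differ by the constant
    [chi k x.1] in the label [s k]. *)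
Lemma cup_sum_step (A : {set I}) k : #|A| = k.+1 -> k < N -> cup_sum A =
  \xor_(x | x \in A) [&& exposed A x, chi k x.1 & cup_sum (A :\ x)].
Proof.
move=> cA ltk; pose w q := s k q && cup s k q.
transitivity (\xor_(x | x \in A) \xor_h (w (upd (subcell A h) x 0)
    (+) w (upd (subcell A h) x L.*2))).
  rewrite /cup_sum cA /=.
  under eq_bigr => h _.
    rewrite /coboundary (eq_bigl (mem A)); last first.
      move=> x; rewrite /subcell -[RHS]/(x \in A).
      by case: (x \in A) => //=; rewrite odd_double.
    over.
  rewrite exchange_big /=; apply: eq_bigr => x xA.
  rewrite -(@xor_telescope _ _ oddL x
    (fun h v => w (upd (subcell A h) x v))).
    by apply: eq_bigr => h _; rewrite /subcell xA.
  move=> h t v; congr w; apply/funext => y; rewrite !updE /subcell ffunE.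
  by case: eqVneq.
apply: eq_bigr => x xA.
have cAx : #|A :\ x| = k by have := cardsD1 x A; rewrite xA cA; lia.
have wD1 h : w (upd (subcell A h) x 0) = w (subcell (A :\ x) h).
  by rewrite subcellD1.
have [vis|hid] := boolP (exposed A x); last first.
  apply: big1 => h _; rewrite wD1 /w.
  by have [-> ->] := cup_opposite_hidden h (ltnW ltk) hid xA; rewrite // addbb.
rewrite /cup_sum cAx /=.
transitivity (\xor_h (w (subcell (A :\ x) h) (+) (w (subcell (A :\ x) (flip_above x h))
    (+) (chi k x.1 && cup s k (subcell (A :\ x) (flip_above x h)))))).
  apply: eq_bigr => h _; rewrite wD1; congr addb; rewrite /w.
  have [-> ->] := cup_opposite_visible h (ltnW ltk) vis; last by [].
  by rewrite andb_addl addbC.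
rewrite !big_split /= addbA.
have re (F : {ffun I -> 'I_L} -> bool) : \xor_h F (flip_above x h) = \xor_h F h.
  by rewrite [RHS](reindex_inj (inv_inj (@flip_aboveK x))).
rewrite (re (fun h => w (subcell (A :\ x) h))) addbb addFb.
rewrite (re (fun h => chi k x.1 && cup s k (subcell (A :\ x) h))).
by rewrite big_distrr.
Qed.

(** The labels do not depend on the free coordinate [x], so the two sides at
    the ends of its range cancel; removing another free coordinate does not
    change this. *)
Lemma cup_sum_hidden (A : {set I}) x y : #|A| <= N ->
    x \in A -> above x y -> y \notin A ->
  cup_sum A = false.
Proof.
move: {2}#|A| (erefl #|A|) => k; elim: k A => [|k IHk] A cA lekN xA xy nyA.
  by rewrite (cards0_eq cA) inE in xA.
rewrite (cup_sum_step cA) -?cA //; apply: big1 => z zA.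
have [->|nzx] := eqVneq z x.
  suff /negPf-> : ~~ exposed A x by [].
  by apply/forallPn; exists y; rewrite xy.
rewrite (IHk (A :\ z)) ?andbF //.
- by have := cardsD1 z A; rewrite zA cA; lia.
- by have := cardsD1 z A; rewrite zA; lia.
- by rewrite in_setD1 eq_sym nzx.
- by rewrite in_setD1 (negPf nyA) andbF.
Qed.

(** When exactly these coordinates are free, the block [b] parametrizes a
    sphere of dimension [a b]. *)
Definition top_coords (a : B -> nat) : {set I} := [set x : I | n <= x.2 + a x.1].

Lemma tops_decr a b (lt : n - a b < n) : 0 < a b -> a b <= n ->
  top_coords (decr a b) = top_coords a :\ (b, Ordinal lt).
Proof.
move=> a0 an; apply/setP => [[b' i]]; rewrite !inE /= xpair_eqE /decr -val_eqE /=.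
by case: eqVneq => [->|_] /=; rewrite ?subn0 //; case: eqVneq => /=; lia.
Qed.

Lemma sum_decr a b : 0 < a b -> \sum_b' a b' = (\sum_b' decr a b b').+1.
Proof.
move=> a0; rewrite (bigD1 b) //= [in RHS](bigD1 b) //= /decr eqxx.
rewrite (eq_bigr (fun b' => a b' - (b' == b))) => [|b' /negPf->].
  by rewrite -addSn; congr addn; lia.
by rewrite subn0.
Qed.

Lemma card_top_coords a : (forall b, a b <= n) -> #|top_coords a| = \sum_b a b.
Proof.
move: {2}(\sum_b a b) (erefl (\sum_b a b)) => k; elim: k a => [|k IHk] a sa an.
  move/eqP: (sa); rewrite sum_nat_eq0 => /forallP a0.
  rewrite sa; apply/eqP; rewrite cards_eq0; apply/eqP/setP => -[b i].
  by rewrite !inE /= (eqP (a0 b)) addn0 leqNgt ltn_ord.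
have [b a0] : exists b, 0 < a b.
  apply/existsP; apply: contra_eqT sa => /existsPn a0.
  rewrite big1 // => b _; apply/eqP; by rewrite -leqn0 leqNgt.
have lt : n - a b < n by have := an b; lia.
have := sum_decr a0; rewrite sa => -[/esym sk].
rewrite (cardsD1 (b, Ordinal lt) (top_coords a)) -(tops_decr lt) // IHk ?sk //.
  by rewrite inE /= subnK ?leqnn.
by move=> b'; apply: leq_trans (leq_subr _ _) (an b').
Qed.

(** By [cup_sum_hidden], only the lowest free coordinate of each block
    contributes to [cup_sum_step]; this is the recursion that defines
    [class_coef]. *)
Lemma cup_sum_tops a : (forall b, a b <= n) -> \sum_b a b <= N ->
  cup_sum (top_coords a) = class_coef (\sum_b a b) a.
Proof.
move: {2 4}(\sum_b a b) (erefl (\sum_b a b)) => k; elim: k a => [|k IHk] a sa an leN.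
  have ca := card_top_coords an; rewrite sa in ca.
  move/eqP: (sa); rewrite sum_nat_eq0 /= => /forallP a0.
  have -> : [forall b, a b == 0] by apply/forallP.
  rewrite /cup_sum ca /= big_const card_ffun card_ord.
  suff E m : iter m (addb true) false = odd m by rewrite E oddX oddL orbT.
  by elim: m => //= m ->.
have ca := card_top_coords an; rewrite sa in ca leN.
rewrite (cup_sum_step ca) //=.
rewrite (eq_bigl (fun x : I => true && (n <= x.2 + a x.1))); last first.
  by move=> x; rewrite inE.
rewrite (eq_bigr (fun x : I => [&& exposed (top_coords a) (x.1, x.2), chi k x.1
  & cup_sum (top_coords a :\ (x.1, x.2))])); last by move=> [].
rewrite -(pair_big_dep xpredT (fun (b : B) (i : 'I_n) => n <= i + a b)
  (fun b i => [&& exposed (top_coords a) (b, i), chi k b &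
    cup_sum (top_coords a :\ (b, i))])).
rewrite /= [RHS]big_mkcond; apply: eq_bigr => b _.
case: posnP => [a0|a0].
  by apply: big_pred0 => i; rewrite a0 addn0 leqNgt ltn_ord.
have lt : n - a b < n by have := an b; lia.
rewrite (bigD1 (Ordinal lt)) /=; last by rewrite subnK.
(* Freezing another coordinate than the lowest one hides the lowest one. *)
rewrite big1 => [|i /andP[le ne]]; last first.
  rewrite (@cup_sum_hidden _ (b, Ordinal lt) (b, i)) ?andbF //.
  - have bi : (b, i) \in top_coords a by rewrite inE.
    by have := cardsD1 (b, i) (top_coords a); rewrite ca bi add1n => -[<-]; exact: ltnW.
  - by rewrite in_setD1 inE /= subnK // leqnn xpair_eqE eqxx /= andbT eq_sym.
  - by rewrite /above /= eqxx /=; move: ne; rewrite -val_eqE /=; lia.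
  - by rewrite !inE eqxx.
rewrite addbF -(tops_decr lt) // IHk //.
- rewrite (_ : exposed _ _) //; apply/forallP => -[b' i] /=.
  apply/implyP => /andP[/= /eqP-> lti]; rewrite inE /=; lia.
- by have := sum_decr a0; lia.
- by move=> b'; apply: leq_trans (leq_subr _ _) (an b').
- by have := sum_decr a0; lia.
Qed.

(** A version of the lemma of Tucker for a product of spheres: every labelling
    takes both values on the faces of some cell. *)
Lemma tucker_product a : (forall b, a b <= n) -> \sum_b a b = N -> class_coef N a ->
  exists2 p : cell, (forall x, p x <= L.*2) &
    forall j, j < N -> exists q q', [/\ is_face p q, is_face p q', s j q & ~~ s j q'].
Proof.
move=> an sa ca; have ct := card_top_coords an; rewrite sa in ct.
have : cup_sum (top_coords a) by rewrite cup_sum_tops // sa.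
move=> /xor_witness[h _]; rewrite ct => /cup_face H.
by exists (subcell (top_coords a) h) => [x|]; [apply: subcell_le|].
Qed.

End Blocks.

(** * The characteristic class of the kernel system *)

Local Notation o0 := (@Ordinal 3 0 isT).
Local Notation o1 := (@Ordinal 3 1 isT).
Local Notation o2 := (@Ordinal 3 2 isT).

Section PairCoefficient.
Local Open Scope nat_scope.

Lemma xor_ord3 (P F : pred 'I_3) : \xor_(b | P b) F b =
  (P o0 && F o0) (+) ((P o1 && F o1) (+) (P o2 && F o2)).
Proof.
rewrite big_mkcond big_ord_recl big_ord_recl big_ord_recl big_ord0 /=.
rewrite (_ : ord0 = o0); last exact: val_inj.
rewrite (_ : lift o0 ord0 = o1); last exact: val_inj.
rewrite (_ : lift o0 _ = o2); last exact: val_inj.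
by case: (P o0); case: (P o1); case: (P o2); rewrite /= ?addbF.
Qed.

Section Coef.
Variable M : nat.

(** The equations are numbered so that the first [M] have class [x + u], the
    next [M] have class [x + v], and the last one has class [u + v]; the
    indices [o0], [o1], [o2] stand for [x], [u], [v]. *)
Definition pair_char (j : nat) (b : 'I_3) : bool :=
  b != (if j < M then o2 else if j < M.*2 then o1 else o0).

Lemma class_coef_first k a : k <= M -> class_coef pair_char k a =
  [&& a o0 + a o1 + a o2 == k, a o2 == 0 & odd 'C(k, a o1)].
Proof.
elim: k a => [|k IHk] a lek.
  rewrite /= bin0n; apply/forallP/and3P => [a0|[s0 _ _] b].
    by split; rewrite ?(eqP (a0 _)).
  have {}s0 : [&& a o0 == 0, a o1 == 0 & a o2 == 0] by lia.
  case/and3P: s0 => s0 s1 s2.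
  case: b => [[|[|[|//]]] lt].
  - by rewrite (_ : Ordinal lt = o0); last exact: val_inj.
  - by rewrite (_ : Ordinal lt = o1); last exact: val_inj.
  - by rewrite (_ : Ordinal lt = o2); last exact: val_inj.
rewrite /= xor_ord3 /pair_char lek /= andbF addbF !IHk ?(ltnW lek) //.
rewrite /decr /= ?subn0.
case: (a o0) => [|m0]; case: (a o1) => [|m1] /=; rewrite ?subn1 ?bin0 /=
  ?binS ?oddD ?addbF; case: (a o2) => [|m2]; rewrite ?andbF ?andbT //=;
  rewrite ?addn0 ?add0n ?addnS ?addSn ?eqSS //.
- by case: eqVneq => // ->; rewrite (@bin_small k k.+1).
- by rewrite andb_addr.
Qed.

Lemma class_coef_second l a : l <= M -> class_coef pair_char (M + l) a =
  (a o0 + a o1 + a o2 == M + l) && odd ('C(M, a o1) * 'C(l, a o2)).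
Proof.
elim: l a => [|l IHl] a lel.
  by rewrite addn0 class_coef_first // bin0n oddM oddb [(a o2 == 0) && _]andbC.
have h1 : M + l < M = false by rewrite ltnNge leq_addr.
have h2 : M + l < M.*2 by rewrite -addnn ltn_add2l.
rewrite addnS /= xor_ord3 /pair_char h1 h2 /= andbF addFb.
rewrite !IHl ?(ltnW lel) // /decr /= ?subn0 !subn1 !oddM.
move: (a o0) (a o1) (a o2) => x y z {h1 h2 IHl a}.
case: x => [|x] /=.
  case: z => [|z] /=.
    rewrite !addn0 add0n; case: eqVneq => // -> /=.
    by rewrite bin_small // ltnS leq_addr.
  rewrite addnS eqSS; case: eqVneq => // e; rewrite binS oddD /=.
  have [lt|ge] := ltnP M y; first by rewrite bin_small.
  rewrite (@bin_small l z.+1) // ltnS leqNgt; apply/negP => ltz.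
  by move: e ge ltz; clear; lia.
rewrite !addSn eqSS; case: z => [|z] /=; first by rewrite !bin0 addbF.
by rewrite ?addnS ?addSn ?eqSS binS oddD; case: eqVneq => //= _; rewrite andb_addr.
Qed.

Lemma class_coef_pair a : class_coef pair_char M.*2.+1 a =
  [&& 0 < a o1, a o0 + a o1 + a o2 == M.*2.+1 &
    odd ('C(M, (a o1).-1) * 'C(M, a o2))] (+)
  [&& 0 < a o2, a o0 + a o1 + a o2 == M.*2.+1 &
    odd ('C(M, a o1) * 'C(M, (a o2).-1))].
Proof.
have h1 : M.*2 < M = false by rewrite ltnNge -addnn leq_addr.
have C2 b := @class_coef_second M b (leqnn M); rewrite addnn in C2.
rewrite /= xor_ord3 /pair_char h1 ltnn /= andbF addFb.
rewrite !C2 /decr /= ?subn0 !subn1.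
move: (a o0) (a o1) (a o2) => x y z.
case: y => [|y]; case: z => [|z] //=; rewrite ?addnS ?addSn ?eqSS //.
Qed.

End Coef.

(** The exponents of the monomial [x^e u^(2j+1) v^e]. *)
Definition dims (e j : nat) (b : 'I_3) : nat := if b == o1 then j.*2.+1 else e.

Lemma class_coef_dims e j : ~~ odd e -> ~~ odd j ->
    odd 'C(e + j, j) -> odd 'C(e + j, j.*2) ->
  class_coef (pair_char (e + j)) (e + j).*2.+1 (dims e j).
Proof.
move=> ee ej c1 c2; rewrite class_coef_pair /dims /=.
rewrite (_ : e + j.*2.+1 + e == _); last by lia.
have ce : odd 'C(e + j, e) by rewrite -bin_sub ?leq_addr // addKn.
have c0 : odd 'C(e + j, j.*2.+1) = false.
  have -> : e + j = (e./2 + j./2).*2 by lia.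
  by rewrite odd_bin_double.
by rewrite !oddM c2 ce c0 /= andbF.
Qed.

End PairCoefficient.

(** * Limits *)

Lemma cvg_mx (T : topologicalType) m n (S : Type) (F : set_system S) {FF : Filter F}
    (f : S -> 'M[T]_(m, n)) (X : 'M[T]_(m, n)) :
  (forall i j, (fun x => f x i j) @ F --> X i j) -> f @ F --> X.
Proof.
move=> fX A [P PX PA]; apply: (@filterS _ F) (fun x => PA (f x)) _.
apply: filter_forall => i; apply: filter_forall => j.
exact: (fX i j _ (PX i j)).
Qed.

Lemma cvg_bigprod (R : realType) (S I : Type) (F : set_system S)
    {FF : Filter F} (r : seq I) (P : pred I) (f : I -> S -> R) (l : I -> R) :
  (forall i, f i @ F --> l i) ->
  (fun x => \prod_(i <- r | P i) f i x) @ F --> \prod_(i <- r | P i) l i.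
Proof.
move=> fl; elim: r => [|i r IHr].
  rewrite big_nil; under eq_fun do rewrite big_nil; exact: cvg_cst.
rewrite big_cons; under eq_fun do rewrite big_cons.
by case: (P i) => //; apply: cvgM.
Qed.

Lemma cvg_bigsum (R : realType) (S I : Type) (F : set_system S)
    {FF : Filter F} (r : seq I) (P : pred I) (f : I -> S -> R) (l : I -> R) :
  (forall i, f i @ F --> l i) ->
  (fun x => \sum_(i <- r | P i) f i x) @ F --> \sum_(i <- r | P i) l i.
Proof.
move=> fl; elim: r => [|i r IHr].
  rewrite big_nil; under eq_fun do rewrite big_nil; exact: cvg_cst.
rewrite big_cons; under eq_fun do rewrite big_cons.
by case: (P i) => //; apply: cvgD.
Qed.

Lemma continuous_eq_on (T U : topologicalType) (F G : T -> U) (A : set T) X :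
  nbhs X A -> (forall Y, A Y -> F Y = G Y) ->
  {for X, continuous G} -> {for X, continuous F}.
Proof.
move=> XA FG cG B; rewrite (FG X (nbhs_singleton XA)) => /cG GB.
by apply: filterS2 XA GB => Y AY; rewrite /= FG.
Qed.

(** A cluster point of an ultrafilter is a limit. *)
Lemma ultra_compact_cvg (T : topologicalType) (S : Type) (U : set_system S)
    (u : S -> T) (K : set T) : UltraFilter U -> compact K ->
  (forall x, K (u x)) -> exists p : T, u @ U --> p.
Proof.
move=> UU cK Ku; have UP : ProperFilter U by exact: ultra_proper.
have [|p [_ cp]] := cK (u @ U) _.
  exact: (filterS (fun x _ => Ku x) (filterT : U setT)).
exists p => A nA; have [//|UA] := in_ultra_setVsetC (u @^-1` A) UU.
by have [y []] := cp (~` A) A UA nA.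
Qed.

(** * Spherical coordinates *)

Section SphereCoordinates.
Variables (R : realType) (r n : nat).
Notation I := ('I_r * 'I_n)%type.

(** A polynomial version of spherical coordinates: starting from the point 1 of
    the line, each coordinate [t] between -1 and 1 sends a point [y] to [((1 -
    t^2) y, t)], which replaces [(sin t y, cos t)]. The rows are not unit
    vectors, but they are nonzero. *)
Definition sphere_pt (t : I -> R) : 'M[R]_(r, n.+1) :=
  \matrix_(b, k) ((if unlift ord0 k is Some i then t (b, i) else 1) *
    \prod_(l < n | (k <= l)%N) (1 - t (b, l) ^+ 2)).

Definition rows_neq0 (X : 'M[R]_(r, n.+1)) := forall b, row b X != 0.

Definition negrow b (X : 'M[R]_(r, n.+1)) : 'M[R]_(r, n.+1) :=
  \matrix_(b', k) ((-1) ^+ (b' == b) * X b' k).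

(** If [i] is the largest index with [t (b, i) != 0], the coordinate of index
    [i + 1] is [t (b, i)]; if there is none, the coordinate of index 0 is 1. *)
Lemma sphere_pt_neq0 t : rows_neq0 (sphere_pt t).
Proof.
move=> b; apply/eqP => /rowP X0.
have [|t0] := boolP [exists i, t (b, i) != 0].
  move=> /existsP[i0 ti0].
  case: (@arg_maxnP _ i0 (fun i => t (b, i) != 0) (fun i : 'I_n => i : nat) ti0).
  move=> i ti imax.
  have := X0 (lift ord0 i); rewrite !mxE liftK.
  rewrite big1 => [|l]; last first.
    rewrite /= /bump /= add1n => lil.
    have [->|tl] := eqVneq (t (b, l)) 0; first by rewrite expr0n subr0.
    by have : (l <= i)%N := imax l tl; rewrite leqNgt lil.
  by move/eqP; rewrite mulr1 (negPf ti).
have {}t0 i : t (b, i) = 0.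
  by apply/eqP; apply: contraNT t0 => ti; apply/existsP; exists i.
have := X0 ord0; rewrite !mxE unlift_none mul1r big1 => [|l _].
  by move/eqP; rewrite oner_eq0.
by rewrite t0 expr0n subr0.
Qed.

Lemma sphere_pt_degenerate t t' x y : above x y -> t y ^+ 2 = 1 ->
  (forall z, z != x -> t' z = t z) -> sphere_pt t' = sphere_pt t.
Proof.
case: x => b i; case: y => b' j /andP[/= /eqP-> ltij] tj tt'.
apply/matrixP => c k; rewrite !mxE.
have [{c}->|ncb] := eqVneq c b; last first.
  have E l : t' (c, l) = t (c, l) by rewrite tt' // xpair_eqE (negPf ncb).
  by under eq_bigr do rewrite E; case: unliftP => [l _|_]; rewrite ?E.
have tj' : t' (b, j) = t (b, j).
  by rewrite tt' // xpair_eqE eqxx /= -val_eqE /= gtn_eqF.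
have [lekj|ltjk] := leqP k j.
  by rewrite !(bigD1 j lekj) /= tj' tj subrr !mul0r !mulr0.
have E (l : 'I_n) : (i < l)%N -> t' (b, l) = t (b, l).
  by move=> ltil; rewrite tt' // xpair_eqE eqxx /= -val_eqE /= gtn_eqF.
congr (_ * _).
  case: unliftP => // l kl; rewrite E //; move: ltjk; rewrite kl /= /bump /=.
  by rewrite add1n ltnS; apply: leq_trans.
by apply: eq_bigr => l lekl; rewrite E //; lia.
Qed.

(** At the ends of the range of [x] the components below [x] vanish, so that
    negating [t x] and the coordinates above [x] negates the whole row. *)
Lemma sphere_pt_negrow t t' x : t x = 1 -> t' x = -1 ->
    (forall y, y != x -> t' y = if above x y then - t y else t y) ->
  sphere_pt t = negrow x.1 (sphere_pt t').
Proof.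
case: x => b i tx t'x tt'; apply/matrixP => c k; rewrite !mxE /=.
have [{c}->|ncb] := eqVneq c b; last first.
  have E l : t' (c, l) = t (c, l).
    by rewrite tt' /above ?xpair_eqE /= (negPf ncb).
  rewrite expr0 mul1r; under [in RHS]eq_bigr do rewrite E.
  by case: unliftP => [l _|_]; rewrite ?E.
rewrite expr1 mulN1r; have [leki|ltik] := leqP k i.
  rewrite !(bigD1 i leki) /= tx t'x sqrrN expr1n subrr.
  by rewrite !mul0r !mulr0 oppr0.
have E (l : 'I_n) : (i < l)%N -> t' (b, l) = - t (b, l).
  move=> ltil; rewrite tt' /above /= ?eqxx ?ltil //.
  by rewrite xpair_eqE eqxx /= -val_eqE /= gtn_eqF.
have -> : \prod_(l < n | (k <= l)%N) (1 - t' (b, l) ^+ 2) =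
          \prod_(l < n | (k <= l)%N) (1 - t (b, l) ^+ 2).
  by apply: eq_bigr => l lekl; rewrite E ?sqrrN //; lia.
rewrite -mulNr; congr (_ * _).
case: unliftP => [l kl|k0]; last by rewrite k0 in ltik.
have := ltik; rewrite kl /= /bump /= add1n ltnS leq_eqVlt => /predU1P[e|lt].
  by rewrite (_ : l = i) ?tx ?t'x ?opprK //; apply: val_inj.
by rewrite E // opprK.
Qed.

Lemma sphere_pt_cvg (S : Type) (F : set_system S) {FF : Filter F}
    (t : S -> I -> R) (t0 : I -> R) :
  (forall x, (fun m => t m x) @ F --> t0 x) ->
  (fun m => sphere_pt (t m)) @ F --> sphere_pt t0.
Proof.
move=> tt0; apply: cvg_mx => b k; rewrite mxE.
under eq_fun do rewrite mxE.
apply: cvgM.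
  by case: unlift => [i|]; [exact: tt0 | exact: cvg_cst].
apply: cvg_bigprod => l.
apply: cvgB; first exact: cvg_cst.
by rewrite expr2; under eq_fun do rewrite expr2; apply: cvgM.
Qed.

(** This tells apart the two vectors of a pair of opposite nonzero rows. *)
Definition leading_neg (X : 'M[R]_(r, n.+1)) b :=
  if [pick k | X b k != 0] is Some k then X b k < 0 else false.

Lemma leading_neg_negrow X b b' : rows_neq0 X ->
  leading_neg (negrow b X) b' = (b' == b) (+) leading_neg X b'.
Proof.
move=> /(_ b') X0; rewrite /leading_neg.
rewrite (@eq_pick _ _ (fun k => X b' k != 0)); last first.
  by move=> k; rewrite mxE mulf_eq0 signr_eq0.
case: pickP => [k Xk|noX]; last first.
  by case/negP: X0; apply/eqP/rowP => k; rewrite !mxE; apply/eqP/negbFE/noX.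
rewrite mxE; case: (b' == b); rewrite ?expr1 ?mulN1r ?mul1r //=.
by rewrite oppr_lt0 -leNgt lt_def Xk.
Qed.

End SphereCoordinates.

(** * A Borsuk-Ulam theorem for products of projective spaces *)

Section BorsukUlam.
Variables (R : realType) (r n : nat) (chi : nat -> 'I_r -> bool) (N : nat).
Variables (f : nat -> 'M[R]_(r, n.+1) -> R).
Notation I := ('I_r * 'I_n)%type.

Hypothesis f_cont : forall j X, (j < N)%N -> rows_neq0 X ->
  {for X, continuous (f j)}.
Hypothesis f_odd : forall j X b, (j < N)%N -> rows_neq0 X ->
  f j (negrow b X) = (-1) ^+ chi j b * f j X.

(** At the zeros of [f j] the sign is chosen so that [equisign_negrow] holds
    without exception. The bounds [equisign_le0] and [equisign_ge0] are not
    affected. *)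
Definition equisign j X :=
  if f j X == 0 then \xor_(b | chi j b) leading_neg X b else f j X < 0.

Lemma equisign_negrow j X b : (j < N)%N -> rows_neq0 X ->
  equisign j (negrow b X) = chi j b (+) equisign j X.
Proof.
move=> ltj X0; rewrite /equisign f_odd // mulf_eq0 signr_eq0 /=.
case: eqVneq => [_|fX].
  under eq_bigr do rewrite leading_neg_negrow //.
  rewrite big_split /=; congr addb; rewrite big_mkcond (bigD1 b) //= eqxx.
  rewrite big1 => [|b' /negPf->]; last by case: ifP.
  by rewrite addbF; case: (chi j b).
case: (chi j b); rewrite ?expr1 ?mulN1r ?mul1r //=.
by rewrite oppr_lt0 -leNgt lt_def fX.
Qed.

Lemma equisign_le0 j X : equisign j X -> f j X <= 0.
Proof. by rewrite /equisign; case: eqVneq => [->//|_ /ltW]. Qed.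

Lemma equisign_ge0 j X : ~~ equisign j X -> 0 <= f j X.
Proof. by rewrite /equisign; case: eqVneq => [->//|_]; rewrite -leNgt. Qed.

(** The cell [p] is sent to its centre in the cube of all [t] between -1 and 1;
    the number of edges on a side is odd, as [tucker_product] requires. *)
Definition grid_pt (m : nat) (p : I -> nat) (x : I) : R :=
  (p x)%:R / m.*2.+1%:R - 1.

Lemma borsuk_ulam_grid (a : 'I_r -> nat) m : (forall b, (a b <= n)%N) ->
    (\sum_b a b = N)%N -> class_coef chi N a ->
  exists2 p : I -> nat, (forall x, p x <= m.*2.+1.*2)%N &
    forall j, (j < N)%N -> exists q q', [/\ is_face p q, is_face p q',
      f j (sphere_pt (grid_pt m q)) <= 0 & 0 <= f j (sphere_pt (grid_pt m q'))].
Proof.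
move=> an sa ca; pose L := m.*2.+1.
have L0 : L%:R != 0 :> R by rewrite pnatr_eq0.
have [|||p pL H] := @tucker_product _ n chi L _
  (fun j p => equisign j (sphere_pt (grid_pt m p))) N _ _ a an sa ca.
- by rewrite /= odd_double.
- move=> j x y p v _ xy py; congr equisign.
  apply: sphere_pt_degenerate xy _ _ => [|z /negPf nzx].
    by rewrite /grid_pt py mul0r sub0r sqrrN expr1n.
  by rewrite /grid_pt /upd nzx.
- move=> j x p ltj pL px.
  rewrite (@sphere_pt_negrow _ _ _ (grid_pt m p)
    (grid_pt m (opposite L (above x) x p)) x).
  + by rewrite equisign_negrow ?addbA ?addbb //; apply: sphere_pt_neq0.
  + by rewrite /grid_pt px -/L -muln2 natrM mulrAC divff // mul1r; lra.
  + by rewrite /grid_pt /opposite eqxx mul0r sub0r.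
  + move=> y /negPf nyx; rewrite /grid_pt /opposite nyx; case: ifP => // _.
    by rewrite natrB // -muln2 natrM -/L; field.
exists p => // j ltj.
have [q [q' [pq pq' /equisign_le0 sq /equisign_ge0 sq']]] := H j ltj.
by exists q, q'.
Qed.

(** The cells given by [borsuk_ulam_grid] for finer and finer grids converge
    along an ultrafilter. On the faces of these cells each [f j] takes values
    of both signs, so it vanishes at the limit. *)
Theorem borsuk_ulam_product (a : 'I_r -> nat) : (forall b, (a b <= n)%N) ->
    (\sum_b a b = N)%N -> class_coef chi N a ->
  exists2 X, rows_neq0 X & forall j, (j < N)%N -> f j X = 0.
Proof.
move=> an sa ca.
have exp : forall m, exists p : I -> nat, (forall x, p x <= m.*2.+1.*2)%N /\
    forall j, (j < N)%N -> exists q q', [/\ is_face p q, is_face p q',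
      f j (sphere_pt (grid_pt m q)) <= 0 & 0 <= f j (sphere_pt (grid_pt m q'))].
  by move=> m; have [p] := borsuk_ulam_grid m an sa ca; exists p.
have [p pP] := choice exp.
have [U [UU sU]] := ultraFilterLemma (@eventually_filter).
have UP : ProperFilter U by exact: ultra_proper.
have ext : forall x, exists c : R, (fun m => grid_pt m (p m) x) @ U --> c.
  move=> x.
  apply: (@ultra_compact_cvg R _ U (fun m => grid_pt m (p m) x) `[-1, 1]) => [|m].
  - exact: segment_compact.
  - have [/(_ x) pL _] := pP m.
    rewrite /= in_itv /= /grid_pt -(lerD2r 1) addNr subrK divr_ge0 //=.
    rewrite lerBlDr ler_pdivrMr ?ltr0n //.
    by rewrite -[1 + 1]/(2%:R) -natrM ler_nat mul2n.
have [t0 pt] := choice ext.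
have near_t0 (q : nat -> I -> nat) : (forall m, is_face (p m) (q m)) ->
    forall x, (fun m => grid_pt m (q m) x) @ U --> t0 x.
  move=> pq x.
  have H : (fun m => grid_pt m (q m) x - grid_pt m (p m) x) @ U --> (0 : R).
    apply: (@cvg_trans _ ((fun m => grid_pt m (q m) x - grid_pt m (p m) x) @ \oo)).
      by move=> A; apply: sU.
    apply/norm_cvg0P.
    apply: (@squeeze_cvgr _ _ _ _ (fun=> 0) (harmonic)); last 2 first.
    + exact: cvg_cst.
    + exact: cvg_harmonic.
    near=> m; rewrite normr_ge0 /= /grid_pt.
    rewrite opprB addrA subrK -mulrBl normrM normfV (@ger0_norm _ m.*2.+1%:R) ?ler0n //.
    have d : `|(q m x)%:R - (p m x)%:R| <= 1 :> R.
      case: (pq m x) => [-> | [pm_odd [-> | ->]]]; first by rewrite subrr normr0.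
        by case: (p m x) pm_odd => //= k _; rewrite -natr1 opprD addrA subrr sub0r normrN1.
      by rewrite -natr1 addrAC subrr add0r normr1.
    rewrite ler_pdivrMr ?ltr0n //; apply: le_trans d _.
    by rewrite /harmonic mulrC ler_pdivlMr ?ltr0n // mul1r ler_nat; lia.
  have -> : (fun m => grid_pt m (q m) x) =
      (fun m => grid_pt m (q m) x - grid_pt m (p m) x + grid_pt m (p m) x).
    by apply/funext => m; rewrite subrK.
  by rewrite -[t0 x]add0r; apply: cvgD.
have near_X q : (forall m, is_face (p m) (q m)) ->
    (fun m => sphere_pt (grid_pt m (q m))) @ U --> sphere_pt t0.
  by move=> pq; apply: sphere_pt_cvg; apply: near_t0.
exists (sphere_pt t0); first exact: sphere_pt_neq0.
move=> j ltj.
have fc := f_cont ltj (sphere_pt_neq0 t0).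
have exq : forall m, exists qq : (I -> nat) * (I -> nat),
    [/\ is_face (p m) qq.1, is_face (p m) qq.2,
      f j (sphere_pt (grid_pt m qq.1)) <= 0 & 0 <= f j (sphere_pt (grid_pt m qq.2))].
  by move=> m; have [_ /(_ j ltj)[q [q' ?]]] := pP m; exists (q, q').
have [qq qqP] := choice exq.
apply/eqP; rewrite eq_le; apply/andP; split.
- apply: (@cvgr_to_le nat U _ R (fun m => f j (sphere_pt (grid_pt m (qq m).1)))).
    have qp m : is_face (p m) (qq m).1 by have [] := qqP m.
    exact: cvg_comp (near_X _ qp) fc.
  by apply: nearW => m; have [] := qqP m.
- apply: (@cvgr_to_ge nat U _ R (fun m => f j (sphere_pt (grid_pt m (qq m).2)))).
    have qp m : is_face (p m) (qq m).2 by have [] := qqP m.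
    exact: cvg_comp (near_X _ qp) fc.
  by apply: nearW => m; have [] := qqP m.
Unshelve. all: by end_near.
Qed.

End BorsukUlam.

(** * Linear algebra in a tangent space of projective space *)

Lemma row_neq0P (R : realType) n (x : 'rV[R]_n) : x != 0 -> exists i, x 0 i != 0.
Proof.
move=> x0; apply/existsP; apply: contraNT x0 => /existsPn xi.
by apply/eqP/rowP => i; rewrite mxE; apply/eqP/negbNE/xi.
Qed.

Section Scaling.
Variables (R : realType) (n : nat).
Implicit Types x u v : 'rV[R]_n.+1.

(** The coordinates of the line of [x] in the affine chart number [i]. *)
Definition affine (i : 'I_n.+1) (x : 'rV[R]_n.+1) : 'rV[R]_n :=
  \row_l (x 0 (lift i l) / x 0 i).

(** The differential of [affine i] at [x], applied to [u]. *)
Definition tangent (i : 'I_n.+1) (x u : 'rV[R]_n.+1) : 'rV[R]_n :=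
  \row_l (u 0 (lift i l) / x 0 i - x 0 (lift i l) * u 0 i / x 0 i / x 0 i).

Lemma affineZ i c x : c != 0 -> affine i (c *: x) = affine i x.
Proof. by move=> c0; apply/rowP => l; rewrite !mxE -mulf_div divff // mul1r. Qed.

Lemma tangentZl i c x u : c != 0 -> tangent i (c *: x) u = c^-1 *: tangent i x u.
Proof.
move=> c0; apply/rowP => l; rewrite !mxE.
have [->|xi] := eqVneq (x 0 i) 0.
  by rewrite mulr0 invr0 !mulr0 subrr mulr0.
by field; rewrite c0 xi.
Qed.

Lemma tangentD i x u v : tangent i x (u + v) = tangent i x u + tangent i x v.
Proof. by apply/rowP => l; rewrite !mxE; ring. Qed.

Lemma tangentZr i c x u : tangent i x (c *: u) = c *: tangent i x u.
Proof. by apply/rowP => l; rewrite !mxE; ring. Qed.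

(** The kernel of the differential of [affine i] at [x] is the line of [x]. *)
Lemma tangent_eq0 i x u : x 0 i != 0 -> tangent i x u = 0 ->
  u = (u 0 i / x 0 i) *: x.
Proof.
move=> xi /rowP t0; apply/rowP => k; rewrite mxE.
case: (unliftP i k) => [l ->|->]; last by rewrite divfK.
have := t0 l; rewrite !mxE => /eqP; rewrite subr_eq0 => /eqP e.
by rewrite -[LHS](divfK xi) e; field.
Qed.

Definition dot x u : R := \sum_k x 0 k * u 0 k.

Lemma dotC x u : dot x u = dot u x.
Proof. by apply: eq_bigr => k _; rewrite mulrC. Qed.

Lemma dotDr x u v : dot x (u + v) = dot x u + dot x v.
Proof. by rewrite -big_split; apply: eq_bigr => k _; rewrite mxE mulrDr. Qed.

Lemma dotZr c x u : dot x (c *: u) = c * dot x u.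
Proof. by rewrite mulr_sumr; apply: eq_bigr => k _; rewrite mxE mulrCA. Qed.

Lemma dot_eq0 x : dot x x = 0 -> x = 0.
Proof.
move=> /eqP; rewrite psumr_eq0 => [/allP x0|k _]; last by rewrite -expr2 sqr_ge0.
apply/rowP => k; rewrite mxE; apply/eqP.
by have := x0 k (mem_index_enum k); rewrite mulf_eq0 orbb.
Qed.

(** Tangent vectors given by independent vectors orthogonal to [x] are
    independent. *)
Lemma no_orthogonal_kernel m i x u v (J : 'M[R]_(n, m)) :
    x 0 i != 0 -> u != 0 -> v != 0 ->
    dot x u = 0 -> dot x v = 0 -> dot u v = 0 ->
    tangent i x u *m J = 0 -> tangent i x v *m J = 0 ->
  (1 < \rank (kermx J))%N.
Proof.
move=> xi u0 v0 xu xv uv uJ vJ.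
pose A := col_mx (tangent i x u) (tangent i x v).
have AJ : (A <= kermx J)%MS.
  by apply/sub_kermxP; rewrite mul_col_mx uJ vJ col_mx0.
apply: leq_trans (mxrankS AJ); suff /eqP-> : row_free A by [].
apply: inj_row_free => c; rewrite -[c]hsubmxK mul_row_col.
set a := lsubmx c; set b := rsubmx c.
rewrite (mx11_scalar a) (mx11_scalar b) !mul_scalar_mx.
move: (a 0 0) (b 0 0) => {a b c}-a b; rewrite -!tangentZr -tangentD => t0.
(* The combination is both proportional and orthogonal to x. *)
have w0 : a *: u + b *: v = 0.
  have e := tangent_eq0 xi t0; set k := _ / _ in e.
  have : dot x (a *: u + b *: v) = 0 by rewrite dotDr !dotZr xu xv !mulr0 addr0.
  rewrite e dotZr => /eqP; rewrite mulf_eq0 => /orP[/eqP->|/eqP/dot_eq0 x0].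
    by rewrite scale0r.
  by rewrite x0 scaler0.
have a0 : a = 0.
  have : dot u (a *: u + b *: v) = 0 by rewrite w0 -[0 in LHS](scale0r u) dotZr mul0r.
  rewrite dotDr !dotZr uv mulr0 addr0 => /eqP; rewrite mulf_eq0.
  by case/orP => [/eqP //|/eqP/dot_eq0 e]; rewrite e eqxx in u0.
have b0 : b = 0.
  have : dot v (a *: u + b *: v) = 0 by rewrite w0 -[0 in LHS](scale0r u) dotZr mul0r.
  rewrite dotDr !dotZr dotC uv mulr0 add0r => /eqP; rewrite mulf_eq0.
  by case/orP => [/eqP //|/eqP/dot_eq0 e]; rewrite e eqxx in v0.
by rewrite a0 b0 raddf0 row_mx0.
Qed.

End Scaling.

(** * The differential of a map defined on projective space *)

Section Lift.
Variables (R : realType) (n m : nat) (f : RP R n -> 'rV[R]_m).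
Notation g i := (f \o @chart_inv R n i).

(** The homogeneous function of degree 0 that corresponds to [f]. Its
    directional derivatives do not refer to a chart, which is why they are used
    instead of the Jacobians of [f]. *)
Definition hlift (x : 'rV[R]_n.+1) : 'rV[R]_m :=
  if insub x is Some z then f (\pi_(RP R n)%qT (z : nzvec R n)) else 0.

Lemma hlift_chart (i : 'I_n.+1) (x : 'rV[R]_n.+1) : x 0 i != 0 ->
  hlift x = g i (affine i x).
Proof.
move=> xi; have x0 : x != 0 by apply: contraNneq xi => ->; rewrite mxE.
rewrite /hlift insubT /= /chart_inv; congr f; apply/eqmodP => /=.
have e : homogeneous i (affine i x) = (x 0 i)^-1 *: x.
  apply/rowP => k; rewrite !mxE; case: unliftP => [l ->|->].
    by rewrite mxE mulrC.
  by rewrite mulVf.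
rewrite /same_line /= e; apply/andP; split; last exact: scalemx_sub.
by rewrite -{1}[x](scalerKV xi) scalemx_sub.
Qed.

(** The chart sends a line to a line, up to a change of the parameter whose
    derivative at 0 is 1. *)
Lemma affine_line (i : 'I_n.+1) (x u : 'rV[R]_n.+1) (h : R) :
    x 0 i != 0 -> x 0 i + h * u 0 i != 0 ->
  affine i (h *: u + x) =
  (h * (x 0 i / (x 0 i + h * u 0 i))) *: tangent i x u + affine i x.
Proof.
move=> xi xhi; apply/rowP => l; rewrite !mxE.
rewrite [h * u 0 i + _]addrC; field.
by rewrite xi xhi.
Qed.

Lemma derive_hlift (i : 'I_n.+1) (x u : 'rV[R]_n.+1) :
    x 0 i != 0 -> differentiable (g i) (affine i x) ->
  'D_u hlift x = tangent i x u *m 'J (g i) (affine i x).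
Proof.
move=> xi dg; set y := affine i x; set w := tangent i x u.
have -> : w *m 'J (g i) y = 'D_w (g i) y by rewrite deriveEjacobian.
apply: cvg_lim => //.
(* hlift (h *: u + x) = g i (y + (h * lam h) *: w), and lam h tends to 1. *)
pose lam (h : R) := x 0 i / (x 0 i + h * u 0 i).
have den : (fun h : R => x 0 i + h * u 0 i) @ nbhs (0 : R) --> x 0 i.
  have den_cont : continuous (fun h : R => x 0 i + h * u 0 i).
    move=> h; apply: cvgD; first exact: cvg_cst.
    by apply: cvgM; [exact: cvg_id | exact: cvg_cst].
  by have := den_cont 0; rewrite /prop_for /continuous_at mul0r addr0.
have lam1 : lam @ nbhs (0 : R) --> (1 : R).
  rewrite -(divff xi); apply: cvgM; first exact: cvg_cst.
  exact: cvgV.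
have nden : \forall h \near (0 : R), x 0 i + h * u 0 i != 0.
  apply: (den [set t | t != 0]); apply: open_nbhs_nbhs; split => //.
have mu0 : (fun h => h * lam h) @ (0 : R)^' --> (0 : R)^'.
  have mu1 : (fun h => h * lam h) @ nbhs (0 : R) --> (0 : R).
    by rewrite -{2}[0 : R](mul0r 1); apply: cvgM => //; exact: cvg_id.
  move=> A dA; have mA := mu1 _ dA.
  apply: filterS2 nden mA => h dh mA h0; apply: mA.
  by rewrite /lam !mulf_eq0 invr_eq0 negb_or h0 negb_or xi dh.
have dw : (fun h => h^-1 *: (g i (h *: w + y) - g i y)) @ (0 : R)^' --> 'D_w (g i) y.
  exact: diff_derivable.
have lam1' : lam @ (0 : R)^' --> (1 : R) by apply: cvg_within_filter.
have dmu : (fun h => (h * lam h)^-1 *: (g i ((h * lam h) *: w + y) - g i y))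
    @ (0 : R)^' --> 'D_w (g i) y.
  by move=> A /dw/mu0.
have H := cvgZ lam1' dmu; rewrite scale1r in H.
have E : \forall h \near (0 : R)^', h^-1 *: ((hlift \o shift x) (h *: u) - hlift x) =
    lam h *: ((h * lam h)^-1 *: (g i ((h * lam h) *: w + y) - g i y)).
  near=> h.
  have h0 : h != 0 by near: h; exact: nbhs_dnbhs_neq.
  have dh : x 0 i + h * u 0 i != 0 by near: h; apply: nbhs_dnbhs.
  rewrite /= (hlift_chart xi) (@hlift_chart i); last by rewrite !mxE addrC.
  rewrite affine_line // scalerA.
  congr (_ *: _).
  by rewrite /lam; field; rewrite xi dh h0.
by move=> A /H HA; apply: filterS2 E HA => h /= -> .
Unshelve. all: by end_near.
Qed.

End Lift.

Section Equations.
Variables (R : realType) (n m : nat) (f : RP R n -> 'rV[R]_m).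
Hypothesis smooth_f : smooth_RP f.
Implicit Types x u : 'rV[R]_n.+1.
Notation D x u := ('D_u (hlift f) x).
Notation g i := (f \o @chart_inv R n i).

Lemma differentiable_chart i y : differentiable (g i) y.
Proof. by have [/(_ y)] := smooth_f i 1. Qed.

(** A homogeneous function of degree 0 has derivatives of degree -1. *)
Lemma derive_hliftZ c d x u : c != 0 -> x != 0 ->
  D (c *: x) (d *: u) = (d / c) *: D x u.
Proof.
move=> c0 /row_neq0P[i xi].
have cxi : (c *: x) 0 i != 0 by rewrite mxE mulf_neq0.
rewrite (derive_hlift _ cxi (differentiable_chart i _)).
rewrite (derive_hlift _ xi (differentiable_chart i _)).
by rewrite tangentZr tangentZl // affineZ // scalerA scalemxAl.
Qed.

Lemma derive_hlift_coord i x u j : x 0 i != 0 ->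
  D x u 0 j = \sum_l tangent i x u 0 l * 'D_(delta_mx 0 l) (g i) (affine i x) 0 j.
Proof.
move=> xi; rewrite (derive_hlift _ xi (differentiable_chart i _)) mxE.
apply: eq_bigr => l _; congr (_ * _).
rewrite deriveEjacobian; last exact: differentiable_chart.
by rewrite -rowE [RHS]mxE.
Qed.

Lemma continuous_derive_hlift r (p q : 'I_r) j (X : 'M[R]_(r, n.+1)) :
  row p X != 0 -> {for X, continuous (fun Y => D (row p Y) (row q Y) 0 j)}.
Proof.
move=> /row_neq0P[i]; rewrite mxE => Xi.
have cc b k : {for X, continuous (fun Y : 'M[R]_(r, n.+1) => Y b k)}.
  exact: coord_continuous.
have nX : nbhs X [set Y : 'M[R]_(r, n.+1) | Y p i != 0].
  by apply: (cc p i [set t | t != 0]); apply: open_nbhs_nbhs; split => //.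
have ca : {for X, continuous (fun Y : 'M[R]_(r, n.+1) => affine i (row p Y))}.
  apply: (@cvg_mx _ _ _ _ (nbhs X) (nbhs_filter X)) => a l; rewrite !mxE.
  under eq_fun do rewrite !mxE.
  by apply: cvgM; [exact: cc | apply: cvgV => //; exact: cc].
apply: (@continuous_eq_on _ _ _ (fun Y : 'M[R]_(r, n.+1) =>
    \sum_l tangent i (row p Y) (row q Y) 0 l *
      'D_(delta_mx 0 l) (g i) (affine i (row p Y)) 0 j) _ _ nX) => [Y Yi|].
  by apply: derive_hlift_coord; rewrite mxE.
apply: (@cvg_bigsum _ _ _ (nbhs X) (nbhs_filter X)) => l; apply: cvgM.
  rewrite !mxE; under eq_fun do rewrite !mxE.
  have cv : (fun Y : 'M[R]_(r, n.+1) => (Y p i)^-1) @ nbhs X --> (X p i)^-1.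
    by apply: cvgV => //; exact: cc.
  apply: cvgB; first by apply: cvgM => //; exact: cc.
  by apply: cvgM => //; apply: cvgM => //; apply: cvgM; exact: cc.
have cD : continuous ('D_(delta_mx 0 l) (g i)).
  by have [_ /(_ (delta_mx 0 l))] := smooth_f i 1.
apply: (@cvg_comp _ _ _ (fun Y => 'D_(delta_mx 0 l) (g i) (affine i (row p Y)))
  (fun z : 'rV[R]_m => z 0 j) _ _ _ _ (@coord_continuous _ _ _ 0 j _)).
exact: cvg_comp ca (cD _).
Qed.
End Equations.

(** * The equations of a plane in the kernel *)

Section System.
Variables (R : realType) (n m : nat) (f : RP R n -> 'rV[R]_m).
Hypothesis smooth_f : smooth_RP f.
Notation space := 'M[R]_(3, n.+1).

(** For [j < m] these are the coordinates of the differential, [j = M - 1] is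
    orthogonality, and the remaining equations are trivial; they raise the
    number of equations to [M]. *)
Definition kernel_eq (M : nat) (p q : 'I_3) (j : nat) (X : space) : R :=
  if insub j is Some j' then ('D_(row q X) (hlift f) (row p X)) 0 (j' : 'I_m)
  else if j.+1 == M then dot (row p X) (row q X) else 0.

Definition plane_eq M (j : nat) : space -> R :=
  if (j < M)%N then kernel_eq M o0 o1 j
  else if (j < M.*2)%N then kernel_eq M o0 o2 (j - M)
  else fun X => dot (row o1 X) (row o2 X).

Lemma row_negrow b p (X : space) : row p (negrow b X) = (-1) ^+ (p == b) *: row p X.
Proof. by apply/rowP => k; rewrite !mxE. Qed.

Lemma dotZ c d (x u : 'rV[R]_n.+1) : dot (c *: x) (d *: u) = c * d * dot x u.
Proof. by rewrite dotZr dotC dotZr dotC mulrA [d * c]mulrC. Qed.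

Lemma kernel_eq_negrow M p q j b X : rows_neq0 X ->
  kernel_eq M p q j (negrow b X) = (-1) ^+ ((p == b) (+) (q == b)) * kernel_eq M p q j X.
Proof.
move=> X0; rewrite signr_addb /kernel_eq !row_negrow.
case: insubP => [j' _ _|_].
  rewrite (derive_hliftZ smooth_f) ?signr_eq0 ?X0 // mxE.
  by rewrite invr_sign [X in X * _]mulrC.
by case: eqP => _; rewrite ?dotZ ?mulr0.
Qed.

Lemma continuous_dot p q (X : space) :
  {for X, continuous (fun Y : space => dot (row p Y) (row q Y))}.
Proof.
apply: (@cvg_bigsum _ _ _ (nbhs X) (nbhs_filter X)) => k.
rewrite !mxE; under eq_fun do rewrite !mxE.
by apply: cvgM; exact: coord_continuous.
Qed.

Lemma kernel_eq_continuous M p q j X : rows_neq0 X ->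
  {for X, continuous (kernel_eq M p q j)}.
Proof.
move=> X0; rewrite /kernel_eq; case: insubP => [j' _ _|_].
  exact: continuous_derive_hlift.
by case: eqP => _; [exact: continuous_dot | exact: cst_continuous].
Qed.

Lemma plane_eq_negrow M j b X : rows_neq0 X ->
  plane_eq M j (negrow b X) = (-1) ^+ pair_char M j b * plane_eq M j X.
Proof.
move=> X0; have b3 : [|| b == o0, b == o1 | b == o2].
  by case: b => [[|[|[|//]]]].
rewrite /plane_eq /pair_char; case: ifP => _.
  rewrite kernel_eq_negrow //; congr (_ ^+ nat_of_bool _ * _).
  by case/or3P: b3 => /eqP->.
case: ifP => _.
  rewrite kernel_eq_negrow //; congr (_ ^+ nat_of_bool _ * _).
  by case/or3P: b3 => /eqP->.
rewrite !row_negrow dotZ -signr_addb; congr (_ ^+ nat_of_bool _ * _).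
by case/or3P: b3 => /eqP->.
Qed.

Lemma plane_eq_continuous M j X : rows_neq0 X -> {for X, continuous (plane_eq M j)}.
Proof.
move=> X0; rewrite /plane_eq; case: ifP => _; first exact: kernel_eq_continuous.
by case: ifP => _; [exact: kernel_eq_continuous | exact: continuous_dot].
Qed.

Lemma kernel_eq_zero M p q X : (m < M)%N ->
    (forall j, (j < M)%N -> kernel_eq M p q j X = 0) ->
  'D_(row q X) (hlift f) (row p X) = 0 /\ dot (row p X) (row q X) = 0.
Proof.
move=> ltmM X0; split.
  apply/rowP => j; have := X0 j (ltn_trans (ltn_ord j) ltmM).
  by rewrite /kernel_eq valK mxE.
have M0 : (0 < M)%N by apply: leq_ltn_trans ltmM.
have := X0 M.-1; rewrite /kernel_eq insubF; last first.
  by apply/negbTE; rewrite -leqNgt -ltnS prednK.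
by rewrite prednK // leqnn eqxx; apply.
Qed.

(** If [m < M], where [M = e + j], the plane equations would have a solution
    with three nonzero rows, hence a plane in the kernel of the differential.
    *)
Lemma Morin_target e j : Morin_map f -> ~~ odd e -> ~~ odd j ->
    (e <= n)%N -> (j.*2 < n)%N ->
    odd 'C(e + j, j) -> odd 'C(e + j, j.*2) ->
  (e + j <= m)%N.
Proof.
move=> [_ corank1] ee ej len ltj c1 c2; rewrite leqNgt; apply/negP => ltm.
set M := (e + j)%N in ltm *.
have dims_le b : (dims e j b <= n)%N by rewrite /dims; case: ifP.
have dims_sum : (\sum_b dims e j b = M.*2.+1)%N.
  by rewrite !big_ord_recl big_ord0 /dims /= /M; lia.
have [X X0 zX] := @borsuk_ulam_product R 3 n (pair_char M) M.*2.+1 (plane_eq M)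
    (fun j' X _ => @plane_eq_continuous M j' X)
    (fun j' X b _ => @plane_eq_negrow M j' b X) (dims e j)
    dims_le dims_sum (class_coef_dims ee ej c1 c2).
have [j1|D1 x1] := @kernel_eq_zero M o0 o1 X ltm.
  move=> ltj1; have := zX j1; rewrite /plane_eq ltj1; apply.
  by apply: leq_trans ltj1 _; rewrite -addnn; lia.
have [j1|D2 x2] := @kernel_eq_zero M o0 o2 X ltm.
  move=> ltj1; have lt2 : (M + j1 < M.*2)%N by lia.
  have nlt : (M + j1 < M)%N = false by lia.
  by have := zX _ (ltnW lt2); rewrite /plane_eq nlt lt2 addKn.
have x12 : dot (row o1 X) (row o2 X) = 0.
  have nlt : (M.*2 < M)%N = false by lia.
  by have := zX M.*2 (ltnSn _); rewrite /plane_eq nlt ltnn.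
have [i xi] := row_neq0P (X0 o0).
have dg := @differentiable_chart R n m f smooth_f i (affine i (row o0 X)).
rewrite (derive_hlift _ xi dg) in D1; rewrite (derive_hlift _ xi dg) in D2.
have := no_orthogonal_kernel xi (X0 o1) (X0 o2) x1 x2 x12 D1 D2.
by rewrite ltnNge corank1.
Qed.

End System.

(* m is the dimension n + k of the target; k may a priori be negative. *)
Theorem corollary5p10 (R : realType) (n : nat) (k : int) (m : nat)
    (hn : (1 <= n)%N) (hm : m%:Z = n%:Z + k)
    (hMorin : exists f : RP R n -> 'rV[R]_m, Morin_map f) :
  (kappa n)%:Z - 1 <= k.
Proof.
have [f Mf] := hMorin; have [j [ej kn ltj c1 c2]] := kappa_excess_exists hn.
have := @Morin_target R n m f (proj1 Mf) (n./2).*2 j Mf _ ej _ ltj c1 c2.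
rewrite odd_double => /(_ isT); have -> : ((n./2).*2 <= n)%N by lia.
move=> /(_ isT); lia.
Qed.
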